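(* For a Hamiltonian stationary torus $f$, the space $H^0_h$ of holomorphic sections with multiplier $h\in\mathrm{Spec}$ is generically complex one-dimensional (i.e. $\dim_{\mathbb C}H^0_h=1$ for all $h\in\mathrm{Spec}$ outside a discrete subset), and its complex dimension is bounded by $$\mathcal N=\Big|\mathcal D\cap\big(\Gamma^*+\tfrac{\beta_0}2\big)\Big|,$$ the number of points of the translated dual lattice $\Gamma^*+\frac{\beta_0}2$ in the closed disk $\mathcal D$ around $\frac{\beta_0}2$ of radius $|\beta_0|$. Moreover, there exists at least one multiplier $h$, namely the trivial multiplier, with $\dim_{\mathbb C}H^0_h\ge4$.
   Context: Identify $\mathbb R^4$ with $\mathbb H$ and $\mathbb C$ with $\mathrm{span}_{\mathbb R}\{1,i\}$; $\langle\cdot,\cdot\rangle$ is the Euclidean inner product on $\mathbb C\cong\mathbb R^2$. $\Gamma\subset\mathbb C$ a lattice, $\Gamma^*=\{\delta:\langle\delta,\gamma\rangle\in\mathbb Z\ \forall\gamma\in\Gamma\}$. A Hamiltonian stationary torus is a $\Gamma$-periodic conformal immersion $f:\mathbb C\to\mathbb H$ with $df=e^{j\beta/2}dz\,g$, $dz=dx+i\,dy$, $g$ nowhere zero, $\beta(z)=2\pi\langle\beta_0,z\rangle$ with $0\ne\beta_0\in\Gamma^*$. Convention $*dz=i\,dz$; left normal $N=e^{j\beta}i$. $\alpha:\mathbb C\to\mathbb H$ is holomorphic if $*d\alpha=N\,d\alpha$. For a homomorphism $h:\Gamma\to\mathbb C_*$, $H^0_h$ is the complex space (scalars on the right) of holomorphic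 $\alpha$ with $\alpha(z+\gamma)=\alpha(z)h(\gamma)$; $\mathrm{Spec}=\{h:H^0_h\ne0\}$. The trivial multiplier is $h\equiv1$. *)

(* Defs.v *)
From HB Require Import structures.
From mathcomp Require Import all_boot all_order all_algebra.
From mathcomp Require Import all_classical all_reals all_analysis.
From mathcomp Require Import complex.
Import Order.TTheory GRing.Theory Num.Theory.
Import numFieldNormedType.Exports.

Set Implicit Arguments.
Unset Strict Implicit.
Unset Printing Implicit Defensive.

Local Open Scope ring_scope.

(* The plane C = R^2 (point (x,y) <-> x + i y) and the quaternions H = R^4. *)
(* A quaternion ((x0,x1),(x2,x3)) stands for x0 + x1 i + x2 j + x3 k.        *)

Definition plane (R : realType) := (R^o * R^o)%type.
Definition quat (R : realType) := ((R^o * R^o) * (R^o * R^o))%type.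

Section Defs.
Variable R : realType.

Definition mkQ (x0 x1 x2 x3 : R) : quat R := ((x0, x1), (x2, x3)).

Definition qmul (p q : quat R) : quat R :=
  let a0 := p.1.1 in let a1 := p.1.2 in let a2 := p.2.1 in let a3 := p.2.2 in
  let b0 := q.1.1 in let b1 := q.1.2 in let b2 := q.2.1 in let b3 := q.2.2 in
  mkQ (a0 * b0 - a1 * b1 - a2 * b2 - a3 * b3)
      (a0 * b1 + a1 * b0 + a2 * b3 - a3 * b2)
      (a0 * b2 - a1 * b3 + a2 * b0 + a3 * b1)
      (a0 * b3 + a1 * b2 - a2 * b1 + a3 * b0).

Definition Qi : quat R := mkQ 0 1 0 0.
Definition Qj : quat R := mkQ 0 0 1 0.

Definition ofC (l : R[i]) : quat R := mkQ (complex.Re l) (complex.Im l) 0 0.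

Definition rmul (q : quat R) (l : R[i]) : quat R := qmul q (ofC l).

Definition expj (t : R) : quat R := mkQ (cos t) 0 (sin t) 0.

Definition dotP (u v : plane R) : R := u.1 * v.1 + u.2 * v.2.
Definition enorm (u : plane R) : R := Num.sqrt (dotP u u).

Definition lattice_basis (w1 w2 : plane R) : Prop := w1.1 * w2.2 - w1.2 * w2.1 != 0.

Definition latpt (w1 w2 : plane R) (m n : int) : plane R :=
  (m%:~R : R) *: w1 + (n%:~R : R) *: w2.

Definition in_lattice (w1 w2 : plane R) (g : plane R) : Prop :=
  exists m n : int, g = latpt w1 w2 m n.

Definition in_dual (w1 w2 : plane R) (d : plane R) : Prop :=
  forall g, in_lattice w1 w2 g -> dotP d g \is a Num.int.

Definition beta (b0 z : plane R) : R := 2 * pi * dotP b0 z.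

Definition Nrm (b0 z : plane R) : quat R := qmul (expj (beta b0 z)) Qi.

Definition dx (a : plane R -> quat R) (z : plane R) : quat R := 'D_((1 : R), (0 : R)) a z.
Definition dy (a : plane R -> quat R) (z : plane R) : quat R := 'D_((0 : R), (1 : R)) a z.

(* Hamiltonian stationary torus: Gamma-periodic immersion f with
   df = e^{j beta/2} dz g, i.e. f_x = e^{j beta/2} g, f_y = e^{j beta/2} i g,
   g nowhere zero, beta0 a nonzero element of Gamma^*.  *)
Definition HS_torus (w1 w2 b0 : plane R) (f g : plane R -> quat R) : Prop :=
  [/\ lattice_basis w1 w2, b0 != 0 & in_dual w1 w2 b0] /\
  [/\ (forall z m n, f (z + latpt w1 w2 m n) = f z),
      (forall z, differentiable f z),
      (forall z, dx f z = qmul (expj (beta b0 z / 2)) (g z)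
              /\ dy f z = qmul (expj (beta b0 z / 2)) (qmul Qi (g z)))
    & (forall z, g z != 0)].

(* holomorphic: *d alpha = N d alpha.  With *dz = i dz one has *dx = -dy,
   *dy = dx, so *d alpha = alpha_y dx - alpha_x dy and the equation reads
   alpha_y = N alpha_x and - alpha_x = N alpha_y. *)
Definition holomorphic (b0 : plane R) (a : plane R -> quat R) : Prop :=
  forall z, differentiable a z /\
    (dy a z = qmul (Nrm b0 z) (dx a z) /\ - dx a z = qmul (Nrm b0 z) (dy a z)).

(* multipliers h : Gamma -> C_* , recorded through (h(w1), h(w2)) *)
Definition multiplier := (R[i] * R[i])%type.
Definition mult_val (h : multiplier) (m n : int) : R[i] := h.1 ^ m * h.2 ^ n.
Definition trivial_mult : multiplier := (1, 1).

Definition H0 (w1 w2 b0 : plane R) (h : multiplier) (a : plane R -> quat R) : Prop :=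
  holomorphic b0 a /\
  forall z m n, a (z + latpt w1 w2 m n) = rmul (a z) (mult_val h m n).

Definition C_indep (n : nat) (a : 'I_n -> plane R -> quat R) : Prop :=
  forall c : 'I_n -> R[i],
    (forall z, \sum_(i < n) rmul (a i z) (c i) = 0) -> forall i, c i = 0.

Definition dimC_ge (S : (plane R -> quat R) -> Prop) (n : nat) : Prop :=
  exists a : 'I_n -> plane R -> quat R, (forall i, S (a i)) /\ C_indep a.
Definition dimC_le (S : (plane R -> quat R) -> Prop) (n : nat) : Prop :=
  ~ dimC_ge S n.+1.
Definition dimC_eq (S : (plane R -> quat R) -> Prop) (n : nat) : Prop :=
  dimC_ge S n /\ dimC_le S n.

Definition Spec (w1 w2 b0 : plane R) (h : multiplier) : Prop :=
  [/\ h.1 != 0, h.2 != 0 &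
    exists a, H0 w1 w2 b0 h a /\ exists z, a z != 0].

Definition discrete_set (D : set multiplier) : Prop :=
  forall h, D h -> exists eps : R[i], 0 < eps /\
    forall h', D h' -> `|h'.1 - h.1| < eps -> `|h'.2 - h.2| < eps -> h' = h.

Definition in_calD (w1 w2 b0 : plane R) (p : plane R) : Prop :=
  (exists d, in_dual w1 w2 d /\ p = d + (2^-1 : R) *: b0) /\
  enorm (p - (2^-1 : R) *: b0) <= enorm b0.

End Defs.

(* Main.v *)
Require Import Defs.
From HB Require Import structures.
From mathcomp Require Import all_boot all_order all_algebra.
From mathcomp Require Import all_classical all_reals all_analysis.
From mathcomp Require Import complex zify ring lra.
Import Order.TTheory GRing.Theory Num.Theory.
Import numFieldNormedType.Exports.
Local Open Scope ring_scope.

(** Write a section as [u + j v].  In the coordinates [P = u + i v], [Q = u - i v] the equation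
    [*d alpha = N d alpha] becomes [P_y = i e^(i beta) Q_x], [Q_y = i e^(-i beta) P_x].  After
    multiplication by an exponential [e^(-m)] inducing the inverse multiplier, [P] and [Q] are
    periodic, and each equation is a divergence identity relating one Fourier coefficient of [P] to
    one of [Q].  Sections are merely differentiable, so these identities come from Goursat's
    bisection.  A pair of coefficients can be nonzero only if the complex frequency [m] satisfies
    [m . (m - 2 pi i beta_0) = 0], and then it lies on a line; Fourier uniqueness thus bounds the
    dimension by the number of frequencies [m] in a coset of [2 pi i Gamma^*] on this quadric.
    Their real part [y] is fixed by [|h|] and their centred imaginary part [u] satisfies [u . y = 0]
    and [|u|^2 = |y|^2 + |pi beta_0|^2].  For [y = 0] all differences of such frequencies come from
    points of [Gamma^*] of norm at most [|beta_0|]; for [y <> 0] there are at most two frequencies.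
    A difference [k] of two of them determines both up to a sign and is bounded in terms of
    [|h|], so the multipliers of higher dimension form a discrete set.  For the trivial multiplier
    the sections [1], [j], [f], [f j] are independent because [f] is not constant. *)

(** * Dyadic averages over squares, and the divergence theorem by bisection *)

Section DyadicAverages.
Local Open Scope classical_set_scope.
Local Open Scope ring_scope.
Variable R : realType.
Implicit Types (F G : R -> R -> R) (x y h : R).

(** Cousin's lemma, the form in which compactness is used below. If [P] failed on a square, it would
    fail on one of its quarters, and so on; the nested failing squares shrink to a point, where the
    local hypothesis is contradicted. *)
Lemma cousin_square (P : R -> R -> R -> Prop) :
  (forall x y h, 0 < h -> P x y (h / 2) -> P (x + h / 2) y (h / 2) ->
     P x (y + h / 2) (h / 2) -> P (x + h / 2) (y + h / 2) (h / 2) -> P x y h) ->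
  (forall x0 y0, exists2 r, 0 < r & forall x y h, 0 < h < r ->
     x <= x0 <= x + h -> y <= y0 <= y + h -> P x y h) ->
  forall x y h, 0 < h -> P x y h.
Proof.
move=> Psub Ploc x y h h0; apply: contrapT => nP.
(* The successor must be total for [choice], hence the implication: where it is vacuous any value
   serves. *)
have step (q : R * R * R) : exists q' : R * R * R, 0 < q.2 -> ~ P q.1.1 q.1.2 q.2 ->
    [/\ ~ P q'.1.1 q'.1.2 q'.2, q'.2 = q.2 / 2,
        q.1.1 <= q'.1.1 <= q.1.1 + q.2 / 2 & q.1.2 <= q'.1.2 <= q.1.2 + q.2 / 2].
  case: q => [[a b] k] /=.
  have [k0|k0] := ltP 0 k; last by exists (a, b, k).
  have [p1|p1] := pselect (P a b (k / 2)); last first.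
    by exists (a, b, k / 2) => /= _ _; split => //; lra.
  have [p2|p2] := pselect (P (a + k / 2) b (k / 2)); last first.
    by exists (a + k / 2, b, k / 2) => /= _ _; split => //; lra.
  have [p3|p3] := pselect (P a (b + k / 2) (k / 2)); last first.
    by exists (a, b + k / 2, k / 2) => /= _ _; split => //; lra.
  have [p4|p4] := pselect (P (a + k / 2) (b + k / 2) (k / 2)); last first.
    by exists (a + k / 2, b + k / 2, k / 2) => /= _ _; split => //; lra.
  by exists (a, b, k) => /= _ []; apply: Psub.
have [nxt nxtP] := choice step.
pose q n := iter n nxt (x, y, h).
have qP n : 0 < (q n).2 /\ ~ P (q n).1.1 (q n).1.2 (q n).2.
  elim: n => [//|n [k0 np]] /=.
  have [np' e _ _] := nxtP _ k0 np; split => //.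
  by rewrite [ltRHS]e; apply: divr_gt0.
have qS n : [/\ (q n.+1).2 = (q n).2 / 2,
    (q n).1.1 <= (q n.+1).1.1 <= (q n).1.1 + (q n).2 / 2
  & (q n).1.2 <= (q n.+1).1.2 <= (q n).1.2 + (q n).2 / 2].
  by have [k0 np] := qP n; have [_ ? ? ?] := nxtP _ k0 np.
(* [c] is a coordinate of the lower left corner. The intervals from [c] to [c] plus the side are
   nested, so the supremum of their left ends lies in all of them. *)
have nested (c : R * R * R -> R) :
    (forall n, c (q n) <= c (q n.+1) <= c (q n) + (q n).2 / 2) ->
    exists x0, forall n, c (q n) <= x0 <= c (q n) + (q n).2.
  move=> cS.
  have inc m n : c (q m) <= c (q (m + n)%N) /\
                 c (q (m + n)%N) + (q (m + n)%N).2 <= c (q m) + (q m).2.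
    elim: n => [|n [IH1 IH2]]; first by rewrite addn0.
    rewrite addnS; have := cS (m + n)%N; have [-> _ _] := qS (m + n)%N.
    by have [k0 _] := qP (m + n)%N; move=> /andP[? ?]; split; lra.
  have bd m n : c (q m) <= c (q n) + (q n).2.
    have [k0 _] := qP m; have [k1 _] := qP n.
    have [mn|/ltnW nm] := leqP m n.
      by have [] := inc m (n - m)%N; rewrite subnKC //; lra.
    by have [] := inc n (m - n)%N; rewrite subnKC //; lra.
  exists (sup (range (fun n => c (q n)))) => n; apply/andP; split.
    apply: ub_le_sup; last by exists n.
    by exists (c (q 0%N) + (q 0%N).2) => _ [m _ <-]; apply: bd.
  by apply: ge_sup; [exists (c (q 0%N)); exists 0%N|move=> _ [m _ <-]; apply: bd].
have [x0 x0P] : exists x0, forall n, (q n).1.1 <= x0 <= (q n).1.1 + (q n).2.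
  by apply: (nested (fun z => z.1.1)) => n; have [] := qS n.
have [y0 y0P] : exists x0, forall n, (q n).1.2 <= x0 <= (q n).1.2 + (q n).2.
  by apply: (nested (fun z => z.1.2)) => n; have [] := qS n.
have [r r0 rP] := Ploc x0 y0.
have qh n : (q n).2 = h / 2 ^+ n.
  elim: n => [|n IH]; first by rewrite expr0 divr1.
  by have [-> _ _] := qS n; rewrite IH exprSr invfM mulrA.
have [n hn] : exists n, h / 2 ^+ n < r.
  have : (fun n => h * 2^-1 ^+ n) @ \oo --> 0.
    by rewrite -(mulr0 h); apply: cvgMr; apply: cvg_expr; rewrite ger0_norm; lra.
  move=> /cvgr0Pnorm_lt /(_ r r0) [N _ /(_ N (leqnn _))] /= H.
  by exists N; rewrite -exprVn; apply: le_lt_trans (ler_norm _) H.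
have [k0 np] := qP n; apply: np; apply: rP => //.
by rewrite k0 qh.
Qed.

(** The mean of [F] over the lower left corners of the [4^n] dyadic subsquares. Recursion by
    quartering matches [cousin_square], and limits of these averages take the place of integrals. *)
Fixpoint avg n F x y h : R :=
  if n is m.+1 then
    (avg m F x y (h / 2) + avg m F (x + h / 2) y (h / 2)
     + avg m F x (y + h / 2) (h / 2) + avg m F (x + h / 2) (y + h / 2) (h / 2)) / 4
  else F x y.

Lemma avgD n F G x y h :
  avg n (fun s t => F s t + G s t) x y h = avg n F x y h + avg n G x y h.
Proof. by elim: n x y h => [//|n IH] x y h /=; rewrite !IH; field. Qed.

Lemma avgZ n c F x y h : avg n (fun s t => c * F s t) x y h = c * avg n F x y h.
Proof. by elim: n x y h => [//|n IH] x y h /=; rewrite !IH; field. Qed.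

Lemma avg_cst n c x y h : avg n (fun _ _ => c) x y h = c.
Proof. by elim: n x y h => [//|n IH] x y h /=; rewrite !IH; field. Qed.

(** Only lower left corners are sampled, so half-open squares suffice. *)
Lemma ler_avg n F G x y h : 0 < h ->
  (forall s t, x <= s < x + h -> y <= t < y + h -> F s t <= G s t) ->
  avg n F x y h <= avg n G x y h.
Proof.
elim: n x y h => [|n IH] x y h h0 FG /=; first by apply: FG; lra.
have sub a b : x <= a <= x + h / 2 -> y <= b <= y + h / 2 ->
    avg n F a b (h / 2) <= avg n G a b (h / 2).
  by move=> ? ?; apply: IH => [|s t ? ?]; [lra|apply: FG; lra].
rewrite ler_pM2r ?invr_gt0 ?ltr0n //; do ![apply: lerD]; apply: sub; lra.
Qed.

Definition cts2 F := forall s t e, 0 < e -> exists2 r, 0 < r &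
  forall s' t', `|s' - s| < r -> `|t' - t| < r -> `|F s' t' - F s t| <= e.

Definition dif2 F s t a b := forall e, 0 < e -> exists2 r, 0 < r &
  forall s' t', `|s' - s| < r -> `|t' - t| < r ->
    `|F s' t' - F s t - ((s' - s) * a + (t' - t) * b)| <= e * (`|s' - s| + `|t' - t|).

Lemma avg_near n F x y h c e : 0 < h ->
  (forall s t, x <= s < x + h -> y <= t < y + h -> `|F s t - c| <= e) ->
  `|avg n F x y h - c| <= e.
Proof.
move=> h0 Fc.
rewrite ler_norml; apply/andP; split.
  rewrite lerBrDr -[X in X <= _](avg_cst n _ x y h).
  by apply: ler_avg => // s t sx ty; have := Fc s t sx ty; rewrite ler_norml; lra.
rewrite lerBlDr -[X in _ <= X](avg_cst n _ x y h).
by apply: ler_avg => // s t sx ty; have := Fc s t sx ty; rewrite ler_norml; lra.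
Qed.

Lemma near_square s0 t0 x y h s t r : 0 < h < r ->
  x <= s0 <= x + h -> y <= t0 <= y + h -> x <= s <= x + h -> y <= t <= y + h ->
  `|s - s0| < r /\ `|t - t0| < r.
Proof. by move=> *; split; rewrite ltr_norml; lra. Qed.

Lemma cts2_bounded F x y h : cts2 F -> 0 < h ->
  exists M, forall s t, x <= s <= x + h -> y <= t <= y + h -> `|F s t| <= M.
Proof.
move=> cF; apply: (cousin_square (fun x y h => exists M, forall s t,
   x <= s <= x + h -> y <= t <= y + h -> `|F s t| <= M)).
  move=> {}x {}y {}h h0 [M1 H1] [M2 H2] [M3 H3] [M4 H4].
  exists (Num.max (Num.max M1 M2) (Num.max M3 M4)) => s t sx ty; rewrite !le_max.
  have [sl|sl] := leP s (x + h / 2); have [tl|tl] := leP t (y + h / 2).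
  - by rewrite H1 //; lra.
  - by rewrite H3 ?orbT //; lra.
  - by rewrite H2 ?orbT //; lra.
  - by rewrite H4 ?orbT //; lra.
move=> x0 y0; have [r r0 rP] := cF x0 y0 1 ltr01; exists r => // {}x {}y {}h hr hx hy.
exists (`|F x0 y0| + 1) => s t sx ty.
have [s0 t0] := near_square _ _ _ _ _ _ _ _ hr hx hy sx ty.
rewrite -(subrK (F x0 y0) (F s t)) addrC; apply: le_trans (ler_normD _ _) _.
by rewrite lerD2l rP.
Qed.

(** For each [e] the averages are eventually within [e / 2] of some constant. This passes from the
    quarters to the square, with the mean of the four constants, so the sequence is Cauchy. *)
Lemma avg_cvg F x y h : cts2 F -> 0 < h -> cvgn (fun n => avg n F x y h).
Proof.
move=> cF h0; apply/cauchy_cvgP; apply: cauchy_exP => e e0.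
have [c [N NP]] : exists c N, forall n, (N <= n)%N -> `|avg n F x y h - c| <= e / 2.
  move: x y h h0; apply: (cousin_square (fun x y h =>
    exists c N, forall n, (N <= n)%N -> `|avg n F x y h - c| <= e / 2)).
    move=> x y h h0 [c1 [N1 H1]] [c2 [N2 H2]] [c3 [N3 H3]] [c4 [N4 H4]].
    exists ((c1 + c2 + c3 + c4) / 4), (N1 + N2 + N3 + N4).+1 => -[//|n] nN /=.
    have := H1 n ltac:(lia); have := H2 n ltac:(lia).
    have := H3 n ltac:(lia); have := H4 n ltac:(lia).
    by rewrite !ler_norml; lra.
  move=> x0 y0; have [|r r0 rP] := cF x0 y0 (e / 2); first lra.
  exists r => // x y h hr hx hy; exists (F x0 y0), 0%N => n _.
  apply: avg_near => [|s t sx ty]; first lra.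
  have [||s0 t0] := near_square _ _ _ _ _ s t _ hr hx hy; try lra.
  exact: rP.
exists c; exists N => // n /= nN; rewrite /ball /= distrC.
by apply: le_lt_trans (NP n nN) _; lra.
Qed.

Fixpoint avg1 n (f : R -> R) y h : R :=
  if n is m.+1 then (avg1 m f y (h / 2) + avg1 m f (y + h / 2) (h / 2)) / 2 else f y.

Lemma avg1B n (f g : R -> R) y h :
  avg1 n (fun t => f t - g t) y h = avg1 n f y h - avg1 n g y h.
Proof. by elim: n y h => [//|n IH] y h /=; rewrite !IH; field. Qed.

Lemma avg1_near n f y h c e : 0 < h ->
  (forall t, y <= t < y + h -> `|f t - c| <= e) -> `|avg1 n f y h - c| <= e.
Proof.
elim: n y h => [|n IH] y h h0 fc /=; first by apply: fc; lra.
have H1 : `|avg1 n f y (h / 2) - c| <= e by apply: IH => [|t ?]; [lra|apply: fc; lra].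
have H2 : `|avg1 n f (y + h / 2) (h / 2) - c| <= e.
  by apply: IH => [|t ?]; [lra|apply: fc; lra].
by move: H1 H2; rewrite !ler_norml; lra.
Qed.

(** The outward flux of the field [(Phi, Psi)] per unit area: each side contributes its length [h]
    times an average, and the area is [h^2]. *)
Definition flux n (Phi Psi : R -> R -> R) x y h :=
  (avg1 n (fun t => Phi (x + h) t - Phi x t) y h
   + avg1 n (fun s => Psi s (y + h) - Psi s y) x h) / h.

(** Fluxes through the inner edges cancel, because adjacent quarters sample them at the same
    points. *)
Lemma fluxS n Phi Psi x y h : 0 < h ->
  flux n.+1 Phi Psi x y h =
  (flux n Phi Psi x y (h / 2) + flux n Phi Psi (x + h / 2) y (h / 2)
   + flux n Phi Psi x (y + h / 2) (h / 2)
   + flux n Phi Psi (x + h / 2) (y + h / 2) (h / 2)) / 4.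
Proof.
move=> h0; rewrite /flux /= !avg1B.
have E z : z + h / 2 + h / 2 = z + h by field.
by rewrite !E; field; rewrite gt_eqF.
Qed.

(** Both points are compared with [(x0, y0)], from which each has distance at most [2 h] in the sum
    norm. *)
Lemma dif2_square F x0 y0 a b e r x y h s t s' t' : 0 < e ->
  (forall s' t', `|s' - x0| < r -> `|t' - y0| < r ->
    `|F s' t' - F x0 y0 - ((s' - x0) * a + (t' - y0) * b)|
      <= e * (`|s' - x0| + `|t' - y0|)) ->
  0 < h < r -> x <= x0 <= x + h -> y <= y0 <= y + h ->
  x <= s <= x + h -> y <= t <= y + h -> x <= s' <= x + h -> y <= t' <= y + h ->
  `|F s' t' - F s t - ((s' - s) * a + (t' - t) * b)| <= e * (4 * h).
Proof.
move=> e0 rP hr hx hy sx ty s'x t'y.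
have bound u v : x <= u <= x + h -> y <= v <= y + h ->
    `|F u v - F x0 y0 - ((u - x0) * a + (v - y0) * b)| <= e * (2 * h).
  move=> ux vy; have [ur vr] := near_square x0 y0 x y h u v r hr hx hy ux vy.
  apply: le_trans (rP u v ur vr) _; rewrite ler_pM2l // (_ : 2 * h = h + h); last by ring.
  by apply: lerD; rewrite ler_norml; clear -hx hy ux vy hr; lra.
rewrite (_ : _ - _ = F s' t' - F x0 y0 - ((s' - x0) * a + (t' - y0) * b)
   - (F s t - F x0 y0 - ((s - x0) * a + (t - y0) * b))); last by ring.
apply: le_trans (ler_normB _ _) _.
by have := bound s t sx ty; have := bound s' t' s'x t'y; lra.
Qed.

(* Goursat's bisection: no continuity of the partial derivatives is assumed, only of the
   divergence [G]. *)
Lemma goursat Phi Psi G (a b c d : R -> R -> R) x y h :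
  (forall s t, dif2 Phi s t (a s t) (b s t)) ->
  (forall s t, dif2 Psi s t (c s t) (d s t)) ->
  (forall s t, G s t = a s t + d s t) -> cts2 G -> 0 < h ->
  (fun n => flux n Phi Psi x y h - avg n G x y h) @ \oo --> 0.
Proof.
move=> dPhi dPsi GE cG h0; apply/cvgr0Pnorm_le => e e0.
suff [N NP] : exists N, forall n, (N <= n)%N ->
    `|flux n Phi Psi x y h - avg n G x y h| <= e by exists N.
move: x y h h0; apply: (cousin_square (fun x y h =>
  exists N, forall n, (N <= n)%N -> `|flux n Phi Psi x y h - avg n G x y h| <= e)).
  move=> x y h h0 [N1 H1] [N2 H2] [N3 H3] [N4 H4].
  exists (N1 + N2 + N3 + N4).+1 => -[//|n] nN; rewrite fluxS //=.
  have := H1 n ltac:(lia); have := H2 n ltac:(lia).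
  have := H3 n ltac:(lia); have := H4 n ltac:(lia).
  by rewrite !ler_norml; lra.
(* Each of the two terms of the flux has error at most [4 h] times [e / 9], together [8 e / 9] after
   division by [h]; the average of [G] uses the last ninth. *)
move=> x0 y0; have e9 : 0 < e / 9 by lra.
have [r1 r10 r1P] := dPhi x0 y0 _ e9; have [r2 r20 r2P] := dPsi x0 y0 _ e9.
have [r3 r30 r3P] := cG x0 y0 _ e9.
exists (Num.min r1 (Num.min r2 r3)) => [|x y h]; first by rewrite !lt_min r10 r20.
rewrite !lt_min => /and4P[h0 hr1 hr2 hr3] hx hy; exists 0%N => n _.
have H3 : `|avg n G x y h - G x0 y0| <= e / 9.
  apply: avg_near => // s t sx ty.
  have [|||? ?] := near_square x0 y0 x y h s t r3 _ hx hy _ _.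
  - by rewrite h0.
  - by move: sx => /andP[-> /ltW].
  - by move: ty => /andP[-> /ltW].
  exact: r3P.
have xl : x <= x <= x + h by rewrite lexx lerDl ltW.
have xr : x <= x + h <= x + h by rewrite lexx lerDl ltW.
have yl : y <= y <= y + h by rewrite lexx lerDl ltW.
have yr : y <= y + h <= y + h by rewrite lexx lerDl ltW.
have H1 : `|avg1 n (fun t => Phi (x + h) t - Phi x t) y h - h * a x0 y0| <= e / 9 * (4 * h).
  apply: avg1_near => // t /andP[yt /ltW ty].
  rewrite (_ : h * a x0 y0 = (x + h - x) * a x0 y0 + (t - t) * b x0 y0); last by ring.
  by apply: (@dif2_square _ x0 y0 _ _ _ r1 x y h); rewrite ?h0 ?yt.
have H2 : `|avg1 n (fun s => Psi s (y + h) - Psi s y) x h - h * d x0 y0| <= e / 9 * (4 * h).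
  apply: avg1_near => // s /andP[xs /ltW sx].
  rewrite (_ : h * d x0 y0 = (s - s) * c x0 y0 + (y + h - y) * d x0 y0); last by ring.
  by apply: (@dif2_square _ x0 y0 _ _ _ r2 x y h); rewrite ?h0 ?xs.
have -> : flux n Phi Psi x y h - avg n G x y h =
   (avg1 n (fun t => Phi (x + h) t - Phi x t) y h - h * a x0 y0
    + (avg1 n (fun s => Psi s (y + h) - Psi s y) x h - h * d x0 y0)) / h
   - (avg n G x y h - G x0 y0).
  by rewrite /flux GE; field; rewrite gt_eqF.
apply: le_trans (ler_normB _ _) _.
have : `|avg1 n (fun t => Phi (x + h) t - Phi x t) y h - h * a x0 y0
    + (avg1 n (fun s => Psi s (y + h) - Psi s y) x h - h * d x0 y0)| <= e / 9 * 8 * h.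
  by apply: le_trans (ler_normD _ _) _; move: H1 H2; clear; lra.
rewrite normrM normfV (gtr0_norm h0) -ler_pdivrMr // => H.
move: H3 H; clear; lra.
Qed.

End DyadicAverages.

(** * Real partial derivatives of functions on the plane *)

Section ComplexCalculus.
Variable R : realType.
Local Notation C := R[i].
Implicit Types (f g : plane R -> R^o) (F G : plane R -> C) (p : plane R).

Lemma is_diff_fst (V W : normedModType R) (x : V * W) : is_diff x (@fst V W) (@fst V W).
Proof.
have c : continuous (@fst V W) by move=> q; apply: cvg_fst.
by apply: DiffDef; [exact: linear_differentiable|exact: diff_lin].
Qed.

Lemma is_diff_snd (V W : normedModType R) (x : V * W) : is_diff x (@snd V W) (@snd V W).
Proof.
have c : continuous (@snd V W) by move=> q; apply: cvg_snd.
by apply: DiffDef; [exact: linear_differentiable|exact: diff_lin].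
Qed.

Definition rdif f p (a b : R) := is_diff p f (fun h : plane R => h.1 * a + h.2 * b).

Lemma rdif_cst (c : R) p : rdif (fun=> c) p 0 0.
Proof.
have d := @is_diff_cst R (plane R) R^o c p.
apply: (is_diff_eq d).
by apply/funext => h /=; rewrite !mulr0 addr0.
Qed.

Lemma rdifD f g p a b c d : rdif f p a b -> rdif g p c d ->
  rdif (fun q => f q + g q) p (a + c) (b + d).
Proof.
move=> df dg; apply: (is_diff_eq (is_diffD df dg)).
by apply/funext => h /=; rewrite !mulrDr addrACA.
Qed.

Lemma rdifM f g p a b c d : rdif f p a b -> rdif g p c d ->
  rdif (fun q => f q * g q) p (a * g p + f p * c) (b * g p + f p * d).
Proof.
move=> df dg; apply: (is_diff_eq (is_diffM df dg)).
by apply/funext => h; rewrite !fctE /= /GRing.scale /=; ring.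
Qed.

Lemma rdif_comp (u : R -> R) (du : R) f p a b : is_derive (f p) 1 (u : R^o -> R^o) du ->
  rdif f p a b -> rdif (fun q => u (f q)) p (a * du) (b * du).
Proof.
move=> [u1 u2] df; have du1 : differentiable (u : R^o -> R^o) (f p).
  exact/derivable1_diffP.
have dU := differentiableP du1.
apply: (is_diff_eq (is_diff_comp df dU)).
apply/funext => h /=; rewrite diff1E // derive1E u2 /GRing.scale /=; ring.
Qed.

Lemma rdif_fst p : rdif (fun q => q.1) p 1 0.
Proof.
have d1 := is_diff_fst R^o R^o p.
by apply: (is_diff_eq d1); apply/funext => h /=; rewrite mulr1 mulr0 addr0.
Qed.

Lemma rdif_snd p : rdif (fun q => q.2) p 0 1.
Proof.
have d1 := is_diff_snd R^o R^o p.
by apply: (is_diff_eq d1); apply/funext => h /=; rewrite mulr1 mulr0 add0r.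
Qed.

(** The error of the differential is small against the maximum norm, which is at most the sum norm
    of [dif2]. *)
Lemma rdif_dif2 f p a b : rdif f p a b -> dif2 _ (fun s t => f (s, t)) p.1 p.2 a b.
Proof.
move=> [fd fv] e e0.
have := diff_locally fd; rewrite fv => /eqaddoP /(_ e e0).
move=> /nbhs_normP[r /= r0 rP]; exists r => // s t sp tp.
pose q : plane R := (s - p.1, t - p.2).
have qn : `|q| = Num.max `|s - p.1| `|t - p.2| by [].
have qr : ball_ Num.norm (0 : plane R) r q by rewrite /ball_ /= sub0r normrN qn gt_max sp tp.
have := rP q qr; rewrite /= qn /shift /= !fctE /=.
have -> : q + p = (s, t) by rewrite /q; case: (p) => u v; congr (_, _); rewrite /= subrK.
case: p {fd fv rP qn qr q} sp tp => u v /= sp tp H.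
rewrite -addrA -opprD; apply: le_trans H _.
by rewrite ler_pM2l // ge_max lerDl lerDr !normr_ge0.
Qed.

Lemma continuous_cts2 f : continuous f -> cts2 _ (fun s t => f (s, t)).
Proof.
move=> fc s t e e0; have /cvgrPdist_le /(_ e e0) := fc (s, t).
move=> /nbhs_normP[r /= r0 rP]; exists r => // s' t' sp tp.
have qn : `|(s, t) - (s', t') : plane R| = Num.max `|s - s'| `|t - t'| by [].
have qr : ball_ Num.norm ((s, t) : plane R) r (s', t').
  by rewrite /ball_ /= qn gt_max distrC sp distrC tp.
by rewrite distrC; apply: rP qr.
Qed.

Lemma rdif_continuous f (a b : plane R -> R) :
  (forall p, rdif f p (a p) (b p)) -> cts2 _ (fun s t => f (s, t)).
Proof.
move=> df; apply: continuous_cts2 => p; apply: differentiable_continuous.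
by have [] := df p.
Qed.

End ComplexCalculus.

(** * Complex exponentials and mean values over the unit square *)

Section ComplexMean.
Local Open Scope classical_set_scope.
Local Open Scope ring_scope.
Variable R : realType.
Local Notation C := R[i].
Local Notation re := (@complex.Re R).
Local Notation im := (@complex.Im R).
Implicit Types (F G : plane R -> C) (p : plane R) (m : C * C).

Lemma reM (x y : C) : re (x * y) = re x * re y - im x * im y.
Proof. by case: x y => a b [c d]. Qed.

Lemma imM (x y : C) : im (x * y) = re x * im y + im x * re y.
Proof. by case: x y => a b [c d]. Qed.

Lemma reD (x y : C) : re (x + y) = re x + re y. Proof. by case: x y => a b []. Qed.

Lemma imD (x y : C) : im (x + y) = im x + im y. Proof. by case: x y => a b []. Qed.

Lemma complex_eq (x y : C) : re x = re y -> im x = im y -> x = y.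
Proof. by case: x y => a b [c d] /= -> ->. Qed.

Definition cdif F p (a b : C) :=
  rdif R (fun q => re (F q)) p (re a) (re b) /\ rdif R (fun q => im (F q)) p (im a) (im b).

Lemma rdif_eq (f g : plane R -> R^o) p a b a' b' : rdif R f p a b ->
  f =1 g -> a = a' -> b = b' -> rdif R g p a' b'.
Proof. by move=> df /funext <- <- <-. Qed.

Lemma cdif_cst (c : C) p : cdif (fun=> c) p 0 0.
Proof. by split; apply: rdif_cst. Qed.

Lemma cdifD F G p a b c d : cdif F p a b -> cdif G p c d ->
  cdif (fun q => F q + G q) p (a + c) (b + d).
Proof.
move=> [f1 f2] [g1 g2]; split.
  by apply: rdif_eq (rdifD _ _ _ _ _ _ _ _ f1 g1) _ _ _ => [q||]; rewrite reD.
by apply: rdif_eq (rdifD _ _ _ _ _ _ _ _ f2 g2) _ _ _ => [q||]; rewrite imD.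
Qed.

Lemma cdifM F G p a b c d : cdif F p a b -> cdif G p c d ->
  cdif (fun q => F q * G q) p (a * G p + F p * c) (b * G p + F p * d).
Proof.
move=> [f1 f2] [g1 g2].
have neg := rdifM _ _ _ _ _ _ _ _ (rdif_cst _ (-1) p).
split.
  have h := rdifD _ _ _ _ _ _ _ _ (rdifM _ _ _ _ _ _ _ _ f1 g1)
    (neg _ _ _ (rdifM _ _ _ _ _ _ _ _ f2 g2)).
  apply: rdif_eq h _ _ _ => [q||]; rewrite ?reD ?reM; ring.
have h := rdifD _ _ _ _ _ _ _ _ (rdifM _ _ _ _ _ _ _ _ f1 g2) (rdifM _ _ _ _ _ _ _ _ f2 g1).
apply: rdif_eq h _ _ _ => [q||]; rewrite ?imD ?imM; ring.
Qed.

Lemma cdifZ (k : C) F p a b : cdif F p a b -> cdif (fun q => k * F q) p (k * a) (k * b).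
Proof.
move=> dF; have := cdifM _ _ _ _ _ _ _ (cdif_cst k p) dF.
by rewrite !mul0r !add0r.
Qed.

Definition cexp (z : C) : C :=
  Complex (expR (re z) * cos (im z)) (expR (re z) * sin (im z)).

Lemma cexpD x y : cexp (x + y) = cexp x * cexp y.
Proof.
apply: complex_eq; rewrite ?reM ?imM /= reD imD expRD ?cosD ?sinD; ring.
Qed.

Lemma cexp0 : cexp 0 = 1.
Proof. by apply: complex_eq; rewrite /= expR0 ?cos0 ?sin0 mul1r. Qed.

Lemma cexpN x : cexp (- x) * cexp x = 1.
Proof. by rewrite -cexpD addNr cexp0. Qed.

Lemma cexp_neq0 x : cexp x != 0.
Proof.
by apply/eqP => e; have := cexpN x; rewrite e mulr0 => /eqP; rewrite eq_sym oner_eq0.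
Qed.

Lemma cdif_cexp F p a b : cdif F p a b ->
  cdif (fun q => cexp (F q)) p (a * cexp (F p)) (b * cexp (F p)).
Proof.
move=> [f1 f2].
have E := rdif_comp _ _ _ _ _ _ _ (is_derive_expR (re (F p))) f1.
have K := rdif_comp _ _ _ _ _ _ _ (is_derive_cos (im (F p))) f2.
have S := rdif_comp _ _ _ _ _ _ _ (is_derive_sin (im (F p))) f2.
split.
  apply: rdif_eq (rdifM _ _ _ _ _ _ _ _ E K) _ _ _ => [q||] //=; rewrite ?reM /=; ring.
apply: rdif_eq (rdifM _ _ _ _ _ _ _ _ E S) _ _ _ => [q||] //=; rewrite ?imM /=; ring.
Qed.

(** The exponential of a complex covector. Below, [p] consists of coordinates in the lattice basis,
    so [m] records the values of the covector on [w1] and [w2]. *)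
Definition mode m p : C := cexp (m.1 * (p.1)%:C%C + m.2 * (p.2)%:C%C).

Lemma cdif_mode m p : cdif (mode m) p (m.1 * mode m p) (m.2 * mode m p).
Proof.
apply: cdif_cexp.
have d1 : cdif (fun q => (q.1)%:C%C) p 1 0 by split; [exact: rdif_fst|exact: rdif_cst].
have d2 : cdif (fun q => (q.2)%:C%C) p 0 1 by split; [exact: rdif_snd|exact: rdif_cst].
have := cdifD _ _ _ _ _ _ _ (cdifZ m.1 _ _ _ _ d1) (cdifZ m.2 _ _ _ _ d2).
by rewrite !mulr1 !mulr0 addr0 add0r.
Qed.

Lemma modeD m m' p : mode (m + m') p = mode m p * mode m' p.
Proof. by rewrite /mode -cexpD; congr cexp; rewrite /=; ring. Qed.

Lemma mode_neq0 m p : mode m p != 0. Proof. exact: cexp_neq0. Qed.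

Definition ccts F := cts2 R (fun s t => re (F (s, t))) /\ cts2 R (fun s t => im (F (s, t))).

Lemma cdif_ccts F (a b : plane R -> C) : (forall p, cdif F p (a p) (b p)) -> ccts F.
Proof.
move=> dF; split.
  by apply: (rdif_continuous _ (fun p => re (F p)) (fun p => re (a p)) (fun p => re (b p))) => p; have [] := dF p.
by apply: (rdif_continuous _ (fun p => im (F p)) (fun p => im (a p)) (fun p => im (b p))) => p; have [] := dF p.
Qed.

(** The integral over a period cell. Being a relation, it passes through linear combinations without
    separate convergence proofs. *)
Definition mean F (l : C) :=
  (fun n => avg R n (fun s t => re (F (s, t))) 0 0 1) @ \oo --> re l /\
  (fun n => avg R n (fun s t => im (F (s, t))) 0 0 1) @ \oo --> im l.

Lemma avg_lin n (f g : plane R -> R) a b :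
  avg R n (fun s t => a * f (s, t) + b * g (s, t)) 0 0 1 =
  a * avg R n (fun s t => f (s, t)) 0 0 1 + b * avg R n (fun s t => g (s, t)) 0 0 1.
Proof. by rewrite avgD !avgZ. Qed.

Lemma mean_ex F : ccts F -> exists l, mean F l.
Proof.
move=> [c1 c2].
exists (Complex (limn (fun n => avg R n (fun s t => re (F (s, t))) 0 0 1))
                (limn (fun n => avg R n (fun s t => im (F (s, t))) 0 0 1))).
by split; apply: avg_cvg.
Qed.

Lemma mean_uniq F l l' : mean F l -> mean F l' -> l = l'.
Proof.
move=> [a1 a2] [b1 b2].
by apply: complex_eq; [apply: cvg_unique a1 b1|apply: cvg_unique a2 b2].
Qed.

Lemma mean_eq F G l : mean F l -> F =1 G -> mean G l.
Proof. by move=> FG /funext <-. Qed.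

Lemma cvg_comb (u v : R^nat) a b c d : u @ \oo --> c -> v @ \oo --> d ->
  (fun n => a * u n + b * v n) @ \oo --> a * c + b * d.
Proof. by move=> uc vd; apply: cvgD; apply: cvgMr. Qed.

Lemma meanD F G l l' : mean F l -> mean G l' -> mean (fun p => F p + G p) (l + l').
Proof.
move=> [a1 a2] [b1 b2]; split.
  rewrite reD; under eq_fun do under eq_fun do under eq_fun do rewrite reD.
  by under eq_fun do rewrite avgD; apply: cvgD.
rewrite imD; under eq_fun do under eq_fun do under eq_fun do rewrite imD.
by under eq_fun do rewrite avgD; apply: cvgD.
Qed.

Lemma meanZ k F l : mean F l -> mean (fun p => k * F p) (k * l).
Proof.
move=> [a1 a2]; split.
  rewrite reM -mulNr; under eq_fun do under eq_fun do under eq_fun do rewrite reM -mulNr.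
  by under eq_fun do rewrite (avg_lin _ (fun p => re (F p)) (fun p => im (F p))); apply: cvg_comb.
rewrite imM; under eq_fun do under eq_fun do under eq_fun do rewrite imM.
by under eq_fun do rewrite (avg_lin _ (fun p => im (F p)) (fun p => re (F p))); apply: cvg_comb.
Qed.

Lemma mean_sum (I : Type) (r : seq I) (F : I -> plane R -> C) (l : I -> C) :
  (forall i, mean (F i) (l i)) -> mean (fun p => \sum_(i <- r) F i p) (\sum_(i <- r) l i).
Proof.
move=> Fl; elim: r => [|i r IH].
  apply: (mean_eq (fun=> 0)) => [|p]; last by rewrite big_nil.
  rewrite big_nil; split; rewrite /=; under eq_fun do rewrite avg_cst; exact: cvg_cst.
rewrite big_cons; apply: mean_eq (meanD _ _ _ _ (Fl i) IH) _ => p.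
by rewrite big_cons.
Qed.

(** The contributions of opposite sides of the unit square cancel by periodicity, so the flux is
    zero at every level, and [goursat] makes the mean of the divergence vanish. *)
Lemma mean_div F G (a b c d : plane R -> C) :
  (forall p, cdif F p (a p) (b p)) -> (forall p, cdif G p (c p) (d p)) ->
  (forall p, F (p + (1, 0)) = F p) -> (forall p, G (p + (0, 1)) = G p) ->
  ccts (fun p => a p + d p) -> mean (fun p => a p + d p) 0.
Proof.
move=> dF dG pF pG [c1 c2].
have real (f g : plane R -> R) (a' b' c' d' : plane R -> R) :
    (forall p, rdif R f p (a' p) (b' p)) -> (forall p, rdif R g p (c' p) (d' p)) ->
    (forall p, f (p + (1, 0)) = f p) -> (forall p, g (p + (0, 1)) = g p) ->
    cts2 R (fun s t => a' (s, t) + d' (s, t)) ->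
    (fun n => avg R n (fun s t => a' (s, t) + d' (s, t)) 0 0 1) @ \oo --> (0 : R).
  move=> df dg pf pg cc.
  have := goursat _ (fun s t => f (s, t)) (fun s t => g (s, t)) _ _ _ _ _ 0 0 1
    (fun s t => rdif_dif2 _ _ _ _ _ (df (s, t))) (fun s t => rdif_dif2 _ _ _ _ _ (dg (s, t)))
    (fun s t => erefl) cc ltr01.
  have fl n : flux R n (fun s t => f (s, t)) (fun s t => g (s, t)) 0 0 1 = 0.
    rewrite /flux divr1 !avg1B.
    have -> : (fun t => f (0 + 1, t)) = (fun t => f (0, t)).
      apply/funext => t; rewrite -(pf (0, t)); congr f; congr (_, _); exact/esym/addr0.
    have -> : (fun s => g (s, 0 + 1)) = (fun s => g (s, 0)).
      apply/funext => s; rewrite -(pg (s, 0)); congr g; congr (_, _); exact/esym/addr0.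
    by rewrite !subrr addr0.
  under eq_fun do rewrite fl sub0r.
  set A := (X in _ -> X @ _ --> _) => H.
  have -> : A = - (fun n => - A n) by apply/funext => n; rewrite fctE opprK.
  by rewrite -oppr0; apply: cvgN.
split.
  under eq_fun do under eq_fun do under eq_fun do rewrite reD.
  apply: (real (fun p => re (F p)) (fun p => re (G p)) (fun p => re (a p))
     (fun p => re (b p)) (fun p => re (c p)) (fun p => re (d p))) => [p|p|p|p|].
  - by have [] := dF p.
  - by have [] := dG p.
  - by rewrite pF.
  - by rewrite pG.
  - by move: c1; under eq_fun do under eq_fun do rewrite reD.
under eq_fun do under eq_fun do under eq_fun do rewrite imD.
apply: (real (fun p => im (F p)) (fun p => im (G p)) (fun p => im (a p))
   (fun p => im (b p)) (fun p => im (c p)) (fun p => im (d p))) => [p|p|p|p|].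
- by have [] := dF p.
- by have [] := dG p.
- by rewrite pF.
- by rewrite pG.
- by move: c2; under eq_fun do under eq_fun do rewrite imD.
Qed.

End ComplexMean.

(** * Fourier uniqueness for continuous functions on the unit square *)

Section FourierUniqueness.
Local Open Scope classical_set_scope.
Local Open Scope ring_scope.
Variable R : realType.
Local Notation C := R[i].
Local Notation re := (@complex.Re R).
Local Notation im := (@complex.Im R).
Implicit Types (F : R -> R -> R) (U X : plane R -> C) (p : plane R).

Lemma cts2_comb F G a b : cts2 R F -> cts2 R G ->
  cts2 R (fun s t => a * F s t + b * G s t).
Proof.
have Z c H : cts2 R H -> cts2 R (fun s t => c * H s t).
  move=> cH s t e e0; have c1 : 0 < `|c| + 1 by apply: ltr_wpDl.
  have [|r r0 rP] := cH s t (e / (`|c| + 1)); first exact: divr_gt0.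
  exists r => // s' t' ss tt; rewrite -mulrBr normrM.
  have := rP s' t' ss tt; rewrite ler_pdivlMr // mulrDr mulr1 mulrC => H1.
  by apply: le_trans H1; rewrite lerDl.
move=> /(Z a) cF /(Z b) cG s t e e0; have e2 : 0 < e / 2 by rewrite divr_gt0.
have [r r0 rP] := cF s t _ e2; have [r' r0' rP'] := cG s t _ e2.
exists (Num.min r r') => [|s' t']; first by rewrite lt_min r0.
rewrite !lt_min => /andP[s1 s2] /andP[t1 t2]; rewrite opprD addrACA (splitr e).
by apply: le_trans (ler_normD _ _) _; apply: lerD; [exact: rP|exact: rP'].
Qed.

(** At each level one quarter contains the point and the others contribute nonnegatively, whence the
    factor [4^n]. The subsquare is chosen before [F]: in [fourier_uniq] one subsquare serves all
    powers of the kernel. *)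
Lemma avg_subsquare n x y h s0 t0 : 0 < h -> x <= s0 < x + h -> y <= t0 < y + h ->
  exists x' y', [/\ x' <= s0 < x' + h / 2 ^+ n, y' <= t0 < y' + h / 2 ^+ n &
    forall F a k, (forall s t, x <= s < x + h -> y <= t < y + h -> 0 <= F s t) ->
      (forall s t, x' <= s < x' + h / 2 ^+ n -> y' <= t < y' + h / 2 ^+ n -> a <= F s t) ->
      a / 4 ^+ n <= avg R (n + k) F x y h].
Proof.
elim: n x y h => [|n IH] x y h h0 xs yt.
  exists x, y; rewrite expr0 !divr1; split => // F a k _ aF.
  by have := ler_avg _ k (fun _ _ => a) F x y h h0 aF; rewrite avg_cst expr0 divr1.
have h2 : 0 < h / 2 by rewrite divr_gt0.
have [x1 [xx1 x1s]] : exists x1, (x1 = x \/ x1 = x + h / 2) /\ x1 <= s0 < x1 + h / 2.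
  by have [?|?] := ltP s0 (x + h / 2); [exists x|exists (x + h / 2)];
    (split; [by [left|right]|lra]).
have [y1 [yy1 y1t]] : exists y1, (y1 = y \/ y1 = y + h / 2) /\ y1 <= t0 < y1 + h / 2.
  by have [?|?] := ltP t0 (y + h / 2); [exists y|exists (y + h / 2)];
    (split; [by [left|right]|lra]).
have [x' [y' [xs' yt' H]]] := IH x1 y1 (h / 2) h2 x1s y1t.
exists x', y'; have hE : h / 2 ^+ n.+1 = h / 2 / 2 ^+ n by rewrite exprS invfM mulrA.
rewrite hE; split => // F a k F0 aF.
have quad u v : (u = x \/ u = x + h / 2) -> (v = y \/ v = y + h / 2) ->
    (forall s t, u <= s < u + h / 2 -> v <= t < v + h / 2 -> 0 <= F s t).
  by move=> ux vy s t us vt; apply: F0; case: ux us => ->; case: vy vt => ->; clear -h0; lra.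
have pos u v : (u = x \/ u = x + h / 2) -> (v = y \/ v = y + h / 2) ->
    0 <= avg R (n + k) F u v (h / 2).
  move=> ux vy; have := ler_avg _ (n + k) (fun _ _ => 0) F u v (h / 2) h2 (quad u v ux vy).
  by rewrite avg_cst.
have big : a / 4 ^+ n <= avg R (n + k) F x1 y1 (h / 2) by apply: H => //; apply: quad.
have L : x = x \/ x = x + h / 2 by left.
have L' : x + h / 2 = x \/ x + h / 2 = x + h / 2 by right.
have M : y = y \/ y = y + h / 2 by left.
have M' : y + h / 2 = y \/ y + h / 2 = y + h / 2 by right.
have := pos _ _ L M; have := pos _ _ L' M; have := pos _ _ L M'; have := pos _ _ L' M'.
rewrite addSn /= exprSr invfM mulrA ler_pM2r ?invr_gt0 ?ltr0n //.
by case: xx1 big => ->; case: yy1 => ->; clear; lra.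
Qed.

(** Measured in turns, [x] keeps distance at least [r] from the integers; the cosine decreases over
    the first half turn and is symmetric about it. *)
Lemma cos_turn_le (r x : R) : 0 < r -> r <= `|x| -> `|x| <= 1 - r ->
  cos (2 * pi * x) <= cos (2 * pi * r).
Proof.
move=> r0; have -> : cos (2 * pi * x) = cos (2 * pi * `|x|).
  have pi20 : 0 <= 2 * pi :> R by rewrite mulr_ge0 // pi_ge0.
  by rewrite -[RHS]cos_norm normrM normr_id -(ger0_norm pi20) -normrM cos_norm.
have P := pi_gt0 R.
have main u : r <= u -> u <= 2^-1 -> cos (2 * pi * u) <= cos (2 * pi * r).
  rewrite le_eqVlt => /orP[/eqP <- //|ru] u2; apply: ltW.
  rewrite ltr_cos ?in_itv /=; first by rewrite ltr_pM2l // mulr_gt0.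
    apply/andP; split; first by rewrite mulr_ge0 ?mulr_ge0 ?ltW //; lra.
    by rewrite [2 * pi]mulrC -mulrA ger_pMr //; lra.
  apply/andP; split; first by rewrite mulr_ge0 ?mulr_ge0 ?ltW //; lra.
  by rewrite [2 * pi]mulrC -mulrA ger_pMr //; lra.
move: (`|x|) => u ru ur; have [?|?] := leP u 2^-1; first exact: main.
have -> : cos (2 * pi * u) = cos (2 * pi * (1 - u)).
  rewrite -cosN -[LHS]cosD2pi; congr cos; rewrite -mulr_natl; ring.
by apply: main; lra.
Qed.

(** The covectors [2 pi i k], which are the logarithms of the trivial multiplier. *)
Definition freq (k1 k2 : int) : C * C :=
  (Complex 0 (2 * pi * k1%:~R), Complex 0 (2 * pi * k2%:~R)).

Lemma freqD k1 k2 l1 l2 : freq (k1 + l1) (k2 + l2) = freq k1 k2 + freq l1 l2.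
Proof.
by congr (_, _); apply: complex_eq; rewrite /= ?addr0 // intrD mulrDr.
Qed.

(* The powers of [kernel s0 t0] peak at (s0, t0), and every one of them is a trigonometric
   polynomial. *)
Definition kernel (s0 t0 : R) p : R :=
  (2 + cos (2 * pi * (p.1 - s0)) + cos (2 * pi * (p.2 - t0))) / 4.

(** Euler's formula for both cosines: [8^-1] is half of the factor [4^-1], and the phases absorb the
    shift to [(s0, t0)]. *)
Lemma kernel_freq s0 t0 : exists a b c d : C, forall p, (kernel s0 t0 p)%:C%C =
  (2^-1)%:C%C + (a * mode R (freq 1 0) p + (b * mode R (freq (-1) 0) p
  + (c * mode R (freq 0 1) p + d * mode R (freq 0 (-1)) p))).
Proof.
exists ((8^-1)%:C%C * cexp R (Complex 0 (- (2 * pi * s0)))),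
  ((8^-1)%:C%C * cexp R (Complex 0 (2 * pi * s0))),
  ((8^-1)%:C%C * cexp R (Complex 0 (- (2 * pi * t0)))),
  ((8^-1)%:C%C * cexp R (Complex 0 (2 * pi * t0))) => p.
rewrite -!mulrA /mode -!cexpD.
rewrite (_ : _ + ((freq 1 0).1 * _ + _) = Complex 0 (2 * pi * (p.1 - s0))); last first.
  by apply: complex_eq; rewrite ?reD ?imD ?reM ?imM /=; ring.
rewrite (_ : _ + ((freq (-1) 0).1 * _ + _) = Complex 0 (- (2 * pi * (p.1 - s0)))); last first.
  by apply: complex_eq; rewrite ?reD ?imD ?reM ?imM /=; ring.
rewrite (_ : _ + ((freq 0 1).1 * _ + _) = Complex 0 (2 * pi * (p.2 - t0))); last first.
  by apply: complex_eq; rewrite ?reD ?imD ?reM ?imM /=; ring.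
rewrite (_ : _ + ((freq 0 (-1)).1 * _ + _) = Complex 0 (- (2 * pi * (p.2 - t0)))); last first.
  by apply: complex_eq; rewrite ?reD ?imD ?reM ?imM /=; ring.
by apply: complex_eq; rewrite /kernel ?reD ?imD ?reM ?imM /= expR0 !cosN !sinN; field.
Qed.

(** Each factor of the kernel moves frequencies by at most one step, so the induction quantifies
    over all frequencies. *)
Lemma mean_kernelX U s0 t0 (m : nat) :
  (forall k1 k2, mean R (fun p => mode R (freq k1 k2) p * U p) 0) ->
  forall k1 k2, mean R (fun p => mode R (freq k1 k2) p * (U p * ((kernel s0 t0 p)%:C%C ^+ m))) 0.
Proof.
have [a [b [c [d kE]]]] := kernel_freq s0 t0.
move=> U0; elim: m => [|m IH] k1 k2.
  by apply: mean_eq (U0 k1 k2) _ => p; rewrite expr0 mulr1.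
have H := meanD _ _ _ _ _ (meanZ _ (2^-1)%:C%C _ _ (IH k1 k2))
  (meanD _ _ _ _ _ (meanZ _ a _ _ (IH (k1 + 1) (k2 + 0)))
  (meanD _ _ _ _ _ (meanZ _ b _ _ (IH (k1 + -1) (k2 + 0)))
  (meanD _ _ _ _ _ (meanZ _ c _ _ (IH (k1 + 0) (k2 + 1)))
    (meanZ _ d _ _ (IH (k1 + 0) (k2 + -1)))))).
rewrite !mulr0 !(addr0 (0 : C)) in H.
apply: mean_eq H _ => p.
rewrite !freqD !modeD exprS [X in _ = _ * (_ * (X * _))]kE; ring.
Qed.

Lemma expr_small (q e : R) : 0 <= q < 1 -> 0 < e -> exists m, q ^+ m < e.
Proof.
move=> /andP[q0 q1] e0; have : q ^+ m @[m --> \oo] --> 0.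
  by apply: cvg_expr; rewrite ger0_norm.
move=> /cvgr0Pnorm_lt /(_ e e0) [N _ /(_ N (leqnn _))] /= H.
by exists N; apply: le_lt_trans (ler_norm _) H.
Qed.

Lemma kernel_ge0 s0 t0 p : 0 <= kernel s0 t0 p.
Proof.
rewrite /kernel; have := cos_geN1 (2 * pi * (p.1 - s0)).
by have := cos_geN1 (2 * pi * (p.2 - t0)); lra.
Qed.

(** One coordinate is at least [r] away from the peak, and also from the integer translates of the
    peak, which keeps distance [r] from the sides of the unit square. The other cosine is at most
    one. *)
Lemma kernel_far s0 t0 r s t : 0 < s0 < 1 -> 0 < t0 < 1 -> 0 < r ->
  r <= s0 -> r <= 1 - s0 -> r <= t0 -> r <= 1 - t0 ->
  0 <= s < 1 -> 0 <= t < 1 -> ~~ ((`|s - s0| < r) && (`|t - t0| < r)) ->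
  kernel s0 t0 (s, t) <= (3 + cos (2 * pi * r)) / 4.
Proof.
move=> s01 t01 r0 rs rs' rt rt' s1 t1; rewrite negb_and -!leNgt /kernel /=.
have c1 := cos_le1 (2 * pi * (s - s0)); have c2 := cos_le1 (2 * pi * (t - t0)).
case/orP => far.
  have : cos (2 * pi * (s - s0)) <= cos (2 * pi * r).
    apply: cos_turn_le => //; rewrite ler_norml. lra.
  by move: c2; clear; lra.
have : cos (2 * pi * (t - t0)) <= cos (2 * pi * r).
  by apply: cos_turn_le => //; rewrite ler_norml; lra.
by move: c1; clear; lra.
Qed.

Lemma kernel_near s0 t0 (e : R) : 0 < e -> exists2 r, 0 < r &
  forall s t, `|s - s0| < r -> `|t - t0| < r -> 1 - e <= kernel s0 t0 (s, t).
Proof.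
move=> e0; have /cvgrPdist_le /(_ e e0) := @continuous_cos R 0.
move=> /nbhs_normP[r /= r0 rP]; have P := pi_gt0 R.
have pi20 : 0 < 2 * pi :> R by rewrite mulr_gt0.
exists (r / (2 * pi)) => [|s t ss tt]; first exact: divr_gt0.
have near u : `|u| < r / (2 * pi) -> 1 - e <= cos (2 * pi * u).
  rewrite ltr_pdivlMr // => ur; have := rP (2 * pi * u).
  rewrite /ball_ /= sub0r normrN normrM (gtr0_norm pi20) mulrC => /(_ ur).
  by rewrite cos0 ler_norml; clear; lra.
by rewrite /kernel /=; have := near _ ss; have := near _ tt; clear -e0; lra.
Qed.

(** By contradiction: [phi] times any power of the kernel has mean zero. Yet a fixed subsquare near
    the peak contributes at least a constant times [k1^m], while the negative part is at most
    [S k2^m], with [k2 < k1]. *)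
Lemma fourier_uniq U s0 t0 : ccts R U ->
  (forall k1 k2, mean R (fun p => mode R (freq k1 k2) p * U p) 0) ->
  0 < s0 < 1 -> 0 < t0 < 1 -> U (s0, t0) = 0.
Proof.
move=> [cre cim] U0 s01 t01; apply: contrapT => nz; set z := U (s0, t0) in nz.
(* The real part of the conjugate of [z] times [U], equal to [|z|^2] at [(s0, t0)]. *)
pose phi s t := re z * re (U (s, t)) + im z * im (U (s, t)).
have cphi : cts2 R phi by apply: cts2_comb.
have delta0 : 0 < phi s0 t0.
  rewrite lt0r /phi -/z -!expr2 addr_ge0 ?sqr_ge0 // andbT paddr_eq0 ?sqr_ge0 //.
  rewrite !sqrf_eq0; apply/negP => /andP[/eqP a /eqP b]; apply: nz.
  exact: complex_eq.
have phi0 m : (fun n => avg R n (fun s t => phi s t * kernel s0 t0 (s, t) ^+ m) 0 0 1)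
    @ \oo --> (0 : R).
  have [H _] := meanZ _ (conjc z) _ _ (mean_kernelX U s0 t0 m U0 0 0).
  rewrite mulr0 in H; apply: cvg_trans H; apply: near_eq_cvg; near=> n.
  congr (avg _ _ _ _ _ _); apply/funext => s; apply/funext => t.
  have -> : mode R (freq 0 0) (s, t) = 1.
    by rewrite /mode /= (_ : _ + _ = 0) ?cexp0 //; apply: complex_eq;
       rewrite ?reD ?imD ?reM ?imM /=; ring.
  rewrite mul1r -rmorphXn !reM !imM /= /phi; case: (z) => a b /=; ring.
have [r r0 rP] := cphi s0 t0 (phi s0 t0 / 2) ltac:(lra).
(* Within [rr] of the peak [phi] is at least half its value there; farther out [kernel_far]
   applies. *)
pose rr := Num.min r (Num.min (Num.min s0 (1 - s0)) (Num.min t0 (1 - t0))).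
have rr0 : 0 < rr by rewrite !lt_min r0; lra.
have [rrr rs rs' [rt rt']] : [/\ rr <= r, rr <= s0, rr <= 1 - s0 & rr <= t0 /\ rr <= 1 - t0].
  by rewrite /rr; do !split; rewrite !ge_min lexx ?orbT.
pose k2 := (3 + cos (2 * pi * rr)) / 4.
have cr1 : cos (2 * pi * rr) < 1.
  rewrite -[ltRHS]cos0; have P := pi_gt0 R.
  have p0 : 0 < 2 * pi * rr by rewrite !mulr_gt0.
  have i0 : (0 : R) \in `[0, pi] by rewrite in_itv /= lexx ltW.
  have i1 : 2 * pi * rr \in `[0, pi].
    by rewrite in_itv /= ltW //= [2 * pi]mulrC -mulrA ger_pMr //; lra.
  by rewrite (ltr_cos i0 i1).
have k21 : k2 < 1 by rewrite /k2; lra.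
have k20 : 0 < k2 by rewrite /k2; have := cos_geN1 (2 * pi * rr); lra.
(* [k2] bounds the kernel outside the neighbourhood; [k1], strictly between [k2] and 1, bounds it
   from below close to the peak. *)
pose k1 := (1 + k2) / 2.
have k12 : k2 < k1 by rewrite /k1; lra.
have k10 : 0 < k1 by apply: lt_trans k12.
have [r' r0' rP'] := kernel_near s0 t0 ((1 - k2) / 2) ltac:(lra).
(* The level [n] is fixed before the power [m], so that the loss [4^n] is a constant. *)
have [n nr] : exists n, 2^-1 ^+ n < Num.min rr r'.
  by apply: expr_small; rewrite ?lt_min ?rr0 //; lra.
rewrite lt_min exprVn in nr; case/andP: nr => nrr nr'.
have s01' : 0 <= s0 < 0 + 1 by move: s01; clear; lra.
have t01' : 0 <= t0 < 0 + 1 by move: t01; clear; lra.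
have [x [y [xs yt sub]]] := avg_subsquare n 0 0 1 s0 t0 ltr01 s01' t01'.
have [S SP] := cts2_bounded _ phi 0 0 1 cphi ltr01.
have S0 : 0 <= S by apply: le_trans (SP s0 t0 _ _); rewrite ?normr_ge0 //; move: s01 t01; clear; lra.
have ineq m : phi s0 t0 / 2 * k1 ^+ m / 4 ^+ n <= k2 ^+ m * S.
  rewrite leNgt; apply/negP => lt.
  have gap : 0 < phi s0 t0 / 2 * k1 ^+ m / 4 ^+ n - k2 ^+ m * S by rewrite subr_gt0.
  have /cvgr0Pnorm_lt /(_ _ gap) [N _ /(_ (n + N)%N (leq_addl _ _))] /= := phi0 m.
  (* Adding the constant [k2^m S] makes the integrand nonnegative on the whole square, as [sub]
     demands. *)
  have H := sub (fun s t => phi s t * kernel s0 t0 (s, t) ^+ m + k2 ^+ m * S)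
    (phi s0 t0 / 2 * k1 ^+ m) N.
  rewrite avgD avg_cst in H; rewrite ltr_norml => /andP[_].
  rewrite ltNge => /negP; apply; rewrite lerBlDr; apply: H => s t hs ht.
    have kS : 0 <= k2 ^+ m * S by rewrite mulr_ge0 // exprn_ge0 // ltW.
    have [/andP[ss tt]|far] := boolP ((`|s - s0| < rr) && (`|t - t0| < rr)).
      rewrite addr_ge0 // mulr_ge0 ?exprn_ge0 ?kernel_ge0 //.
      have := rP s t (lt_le_trans ss rrr) (lt_le_trans tt rrr).
      by rewrite ler_norml; move: delta0; clear; lra.
    rewrite add0r in hs ht.
    have kf := kernel_far _ _ _ _ _ s01 t01 rr0 rs rs' rt rt' hs ht far.
    have := SP s t; rewrite add0r => /(_ _ _)/wrap[].
    - by move: hs => /andP[-> /ltW].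
    - by move: ht => /andP[-> /ltW].
    rewrite ler_norml => /andP[lo _].
    have : kernel s0 t0 (s, t) ^+ m <= k2 ^+ m 
      by apply: lerXn2r; [rewrite nnegrE kernel_ge0|rewrite nnegrE ltW|exact: kf].
    have : 0 <= kernel s0 t0 (s, t) ^+ m by apply: exprn_ge0; apply: kernel_ge0.
    move: (_ ^+ m) (k2 ^+ m) lo S0 => u v lo S0 u0 uv.
    have h1 : - S * u <= phi s t * u by rewrite ler_wpM2r.
    have h2 : S * u <= S * v by rewrite ler_wpM2l.
    by move: h1 h2; clear; lra.
  have near1 (u u0 v : R) : v <= u0 < v + 1 / 2 ^+ n -> v <= u < v + 1 / 2 ^+ n ->
      `|u - u0| < (2 ^+ n)^-1.
    by rewrite div1r ltr_norml; clear; lra.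
  have ss := near1 _ _ _ xs hs; have tt := near1 _ _ _ yt ht.
  rewrite -[X in X <= _]addr0; apply: lerD; last by rewrite mulr_ge0 // exprn_ge0 // ltW.
  have p2 : phi s0 t0 / 2 <= phi s t.
    have := rP s t (lt_le_trans (lt_trans ss nrr) rrr) (lt_le_trans (lt_trans tt nrr) rrr).
    by rewrite ler_norml; clear; lra.
  apply: ler_pM; [by rewrite ltW // divr_gt0|by rewrite exprn_ge0 // ltW|exact: p2|].
  apply: lerXn2r; [by rewrite nnegrE ltW|by rewrite nnegrE kernel_ge0|].
  by have := rP' s t (lt_trans ss nr') (lt_trans tt nr'); rewrite /k1; clear; lra.
(* Once [(k2 / k1)^m] drops below [e], [ineq] fails; [S + 1] avoids a division by zero. *)
pose e := phi s0 t0 / 2 / 4 ^+ n / (S + 1).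
have e0 : 0 < e by rewrite !divr_gt0 ?exprn_gt0 //; lra.
have [|m mP] := expr_small (k2 / k1) e _ e0.
  by rewrite divr_ge0 ?ltW //= ltr_pdivrMr ?mul1r.
have := ineq m; rewrite leNgt => /negP; apply.
move: mP; rewrite /e expr_div_n ltr_pdivrMr ?exprn_gt0 // mulrAC ltr_pdivlMr; last by lra.
rewrite mulrDr mulr1 mulrAC => H; apply: le_lt_trans H.
by rewrite lerDl exprn_ge0 // ltW.
Unshelve. all: by end_near.
Qed.

End FourierUniqueness.

(** * Linear relations between Fourier coefficients *)

Section ModeRelation.
Variable R : realType.
Local Notation C := R[i].
Local Notation I := (Complex (0 : R) 1).
Implicit Types (F G P Q : plane R -> C) (p : plane R) (m : C * C).

(* For a covector given by its values [m] on [w1, w2]: its Euclidean coordinates, times the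
   determinant of the basis. *)
Definition mux (w1 w2 : plane R) m : C := (w2.2)%:C%C * m.1 - (w1.2)%:C%C * m.2.
Definition muy (w1 w2 : plane R) m : C := (w1.1)%:C%C * m.2 - (w2.1)%:C%C * m.1.

(** Integration by parts: the Euclidean derivatives of the periodic functions [e^(-m) P] and
    [e^(-m') Q] have mean zero, so each derivative in the equation becomes multiplication by a
    component of the frequency. *)
Lemma mode_relation w1 w2 m m' P Q (Px Py Qx Qy : plane R -> C) lP lQ :
  (forall p, cdif R P p ((w1.1)%:C%C * Px p + (w1.2)%:C%C * Py p)
                        ((w2.1)%:C%C * Px p + (w2.2)%:C%C * Py p)) ->
  (forall p, cdif R Q p ((w1.1)%:C%C * Qx p + (w1.2)%:C%C * Qy p)
                        ((w2.1)%:C%C * Qx p + (w2.2)%:C%C * Qy p)) ->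
  (forall p, mode R (- m) p * Py p = I * mode R (- m') p * Qx p) ->
  (forall p e, e = (1, 0) \/ e = (0, 1) ->
     mode R (- m) (p + e) * P (p + e) = mode R (- m) p * P p) ->
  (forall p e, e = (1, 0) \/ e = (0, 1) ->
     mode R (- m') (p + e) * Q (p + e) = mode R (- m') p * Q p) ->
  mean R (fun p => mode R (- m) p * P p) lP ->
  mean R (fun p => mode R (- m') p * Q p) lQ ->
  muy w1 w2 m * lP = I * mux w1 w2 m' * lQ.
Proof.
move=> dP dQ PDE perP perQ mP mQ.
have dEP p := cdifM _ _ _ _ _ _ _ _ (cdif_mode _ (- m) p) (dP p).
have dEQ p := cdifM _ _ _ _ _ _ _ _ (cdif_mode _ (- m') p) (dQ p).
(* With [D] the determinant of the basis, [D d_x = w2.2 d_s - w1.2 d_t] and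
   [D d_y = w1.1 d_t - w2.1 d_s]. The field given by [dF] and [dG] thus has divergence [D] times
   [d_y (e^(-m) P) - I d_x (e^(-m') Q)]. *)
have dF p := cdifD _ _ _ _ _ _ _ _ (cdifZ _ (- (I * (w2.2)%:C%C)) _ _ _ _ (dEQ p))
  (cdifZ _ (- (w2.1)%:C%C) _ _ _ _ (dEP p)).
have dG p := cdifD _ _ _ _ _ _ _ _ (cdifZ _ (I * (w1.2)%:C%C) _ _ _ _ (dEQ p))
  (cdifZ _ (w1.1)%:C%C _ _ _ _ (dEP p)).
(* The derivatives of [P] and [Q] are not known to be continuous. The equation eliminates them from
   the divergence, leaving this differentiable, hence continuous, combination. *)
have dH p := cdifD _ _ _ _ _ _ _ _ (cdifZ _ (I * mux w1 w2 m') _ _ _ _ (dEQ p))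
  (cdifZ _ (- muy w1 w2 m) _ _ _ _ (dEP p)).
have cH := cdif_ccts _ _ _ _ dH.
have mH := meanD _ _ _ _ _ (meanZ _ (I * mux w1 w2 m') _ _ mQ) (meanZ _ (- muy w1 w2 m) _ _ mP).
have := mean_div _ _ _ _ _ _ _ dF dG.
set H := (X in _ -> _ -> ccts R X -> _).
have HE : H = (fun q => I * mux w1 w2 m' * (mode R (- m') q * Q q)
                 + - muy w1 w2 m * (mode R (- m) q * P q)).
  apply/funext => p; rewrite /H /mux /muy /=.
  have := PDE p; set E := mode R (- m) p; set E' := mode R (- m') p => pde.
  apply/eqP; rewrite -subr_eq0; apply/eqP.
  transitivity (((w1.1)%:C%C * (w2.2)%:C%C - (w2.1)%:C%C * (w1.2)%:C%C) *
                (E * Py p - I * E' * Qx p)); first by ring.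
  by rewrite pde subrr mulr0.
move=> divH; have {}cH : ccts R H by rewrite HE.
have /(mean_uniq _ _ _ _ mH) : mean R (fun q => I * mux w1 w2 m' * (mode R (- m') q * Q q)
                 + - muy w1 w2 m * (mode R (- m) q * P q)) 0.
  apply: mean_eq (divH _ _ cH) (fun p => congr1 (@^~ p) HE) => p.
    by rewrite (perP p _ (or_introl erefl)) (perQ p _ (or_introl erefl)).
  by rewrite (perP p _ (or_intror erefl)) (perQ p _ (or_intror erefl)).
by move=> e; apply/eqP; rewrite eq_sym -subr_eq0 -mulNr e.
Qed.

Lemma mu_eq0 w1 w2 m : lattice_basis w1 w2 -> mux w1 w2 m = 0 -> muy w1 w2 m = 0 -> m = 0.
Proof.
rewrite /lattice_basis => D0 x0 y0.
have DC : (w1.1 * w2.2 - w1.2 * w2.1)%:C%C != 0 :> C.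
  by apply: contra_neq D0 => -[].
have D1 : (w1.1 * w2.2 - w1.2 * w2.1)%:C%C * m.1 = 0.
  transitivity ((w1.1)%:C%C * mux w1 w2 m + (w1.2)%:C%C * muy w1 w2 m).
    by rewrite rmorphB !rmorphM /mux /muy; ring.
  by rewrite x0 y0 !mulr0 addr0.
have D2 : (w1.1 * w2.2 - w1.2 * w2.1)%:C%C * m.2 = 0.
  transitivity ((w2.1)%:C%C * mux w1 w2 m + (w2.2)%:C%C * muy w1 w2 m).
    by rewrite rmorphB !rmorphM /mux /muy; ring.
  by rewrite x0 y0 !mulr0 addr0.
move: D1 D2 => /eqP; rewrite mulf_eq0 (negPf DC) => /eqP m1 /eqP.
by rewrite mulf_eq0 (negPf DC) => /eqP m2; rewrite (surjective_pairing m) m1 m2.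
Qed.

(** The determinant of the two relations in the unknowns [lP] and [lQ] vanishes. Up to the squared
    determinant of the basis this is the quadric [m . (m - b) = 0]. *)
Definition valid_mode (w1 w2 : plane R) (b : C * C) m : Prop :=
  mux w1 w2 m * mux w1 w2 (m - b) + muy w1 w2 m * muy w1 w2 (m - b) = 0.

(** The coefficient that determines the pair: if [m] is zero the relations kill [lQ], since [b] is
    nonzero; otherwise [lQ = 0] forces [lP = 0]. *)
Definition mode_pick (w1 w2 : plane R) m (lP lQ : C) : C :=
  if (mux w1 w2 m == 0) && (muy w1 w2 m == 0) then lP else lQ.

(* Off the valid modes both coefficients vanish; on a valid mode the relations have rank one. *)
Lemma mode_pick_eq0 w1 w2 b m lP lQ : lattice_basis w1 w2 -> b != 0 ->
  muy w1 w2 m * lP = I * mux w1 w2 (m - b) * lQ ->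
  muy w1 w2 (m - b) * lQ = I * mux w1 w2 m * lP ->
  (valid_mode w1 w2 b m -> mode_pick w1 w2 m lP lQ = 0) -> lP = 0 /\ lQ = 0.
Proof.
move=> W b0 r1 r2 pick0.
have I2 : I * I = -1 by apply: complex_eq; rewrite ?reM ?imM /=; ring.
have [v|nv] := eqVneq (mux w1 w2 m * mux w1 w2 (m - b) + muy w1 w2 m * muy w1 w2 (m - b)) 0.
  have := pick0 v; rewrite /mode_pick; case: ifP => [/andP[/eqP x0 /eqP y0] lP0|xy lQ0].
    split => //; apply: contra_neq_eq b0 => lQ0.
    rewrite lP0 !mulr0 in r1 r2.
    have m0 := mu_eq0 _ _ _ W x0 y0; rewrite m0 sub0r in r1 r2.
    rewrite -[b]opprK; apply/eqP; rewrite oppr_eq0; apply/eqP; apply: (mu_eq0 w1 w2) => //.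
      apply/eqP; move/esym/eqP: r1; rewrite !mulf_eq0 (negPf lQ0) orbF => /orP[|//].
      by move=> /eqP[] /eqP; rewrite oner_eq0.
    by apply/eqP; move/eqP: r2; rewrite mulf_eq0 (negPf lQ0) orbF.
  split => //; move: r1 r2; rewrite lQ0 !mulr0 => /eqP r1 /esym/eqP r2.
  apply/eqP; move: r1 r2; rewrite !mulf_eq0; case: (lP == 0); rewrite ?orbT ?orbF //.
  move=> y0; case/orP => [/eqP[] /eqP|x0]; first by rewrite oner_eq0.
  by rewrite x0 y0 in xy.
(* Cramer's rule, with [I * I = -1]: the nonzero determinant annihilates each coefficient. *)
split; apply/eqP.
  rewrite -(inj_eq (mulfI nv)) mulr0 mulrDl.
  rewrite [X in _ + X](_ : _ = muy w1 w2 (m - b) * (muy w1 w2 m * lP)); last by ring.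
  rewrite r1 [X in _ + X](_ : _ = I * mux w1 w2 (m - b) * (muy w1 w2 (m - b) * lQ)); last by ring.
  rewrite r2 [X in _ + X](_ : _ = (I * I) * (mux w1 w2 m * mux w1 w2 (m - b) * lP)); last by ring.
  by rewrite I2 mulN1r subrr.
rewrite -(inj_eq (mulfI nv)) mulr0 mulrDl.
rewrite [X in _ + X](_ : _ = muy w1 w2 m * (muy w1 w2 (m - b) * lQ)); last by ring.
rewrite r2 [X in _ + X](_ : _ = I * mux w1 w2 m * (muy w1 w2 m * lP)); last by ring.
rewrite r1 [X in _ + X](_ : _ = (I * I) * (mux w1 w2 m * mux w1 w2 (m - b) * lQ)); last by ring.
by rewrite I2 mulN1r subrr.
Qed.

(** Continuity carries the vanishing from the open cell to its left and lower sides, and integer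
    translations carry it to the plane. *)
Lemma quasiperiodic_eq0 F (chi : int -> int -> C) : ccts R F ->
  (forall p k1 k2, F (p + (k1%:~R, k2%:~R)) = F p * chi k1 k2) ->
  (forall s t, 0 < s < 1 -> 0 < t < 1 -> F (s, t) = 0) -> forall p, F p = 0.
Proof.
move=> [c1 c2] per F0.
have cell s t : 0 <= s < 1 -> 0 <= t < 1 -> F (s, t) = 0.
  move=> s01 t01.
  have zero (f : R -> R -> R) : cts2 R f ->
      (forall s t, 0 < s < 1 -> 0 < t < 1 -> f s t = 0) -> f s t = 0.
    move=> cf f0; apply: contrapT => /eqP nz; rewrite -normr_gt0 in nz.
    have [r r0 rP] := cf s t (`|f s t| / 2) ltac:(lra).
    pose e := Num.min (r / 2) (Num.min ((1 - s) / 2) ((1 - t) / 2)).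
    have e0 : 0 < e by rewrite !lt_min; move: r0 s01 t01; clear; lra.
    have [e1 e2 e3] : [/\ e <= r / 2, e <= (1 - s) / 2 & e <= (1 - t) / 2].
      by rewrite /e; split; rewrite !ge_min lexx ?orbT.
    have := rP (s + e) (t + e); rewrite ![_ + e]addrC !addrK (gtr0_norm e0).
    rewrite f0; [|by move: e0 e2 s01; clear; lra|by move: e0 e3 t01; clear; lra].
    rewrite sub0r normrN => /(_ _ _)/wrap[||]; try (by move: r0 e1; clear; lra).
    by move: nz; clear; lra.
  apply: complex_eq.
    by apply: (zero (fun s t => complex.Re (F (s, t)))) => // s' t' hs ht; rewrite F0.
  by apply: (zero (fun s t => complex.Im (F (s, t)))) => // s' t' hs ht; rewrite F0.
move=> [s t].
have -> : (s, t) = (s - (Num.floor s)%:~R, t - (Num.floor t)%:~R)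
    + ((Num.floor s)%:~R, (Num.floor t)%:~R) :> plane R.
  by congr (_, _); rewrite /= subrK.
have fl (u : R) : 0 <= u - (Num.floor u)%:~R < 1.
  by have := floor_itv u; rewrite intrD; lra.
by rewrite per cell ?mul0r.
Qed.

End ModeRelation.

(** * Complex coordinates on the quaternions, and lattice coordinates on the plane *)

Section QuaternionicSolutions.
Variable R : realType.
Local Notation C := R[i].
Local Notation I := (Complex (0 : R) 1).
Implicit Types (p z : plane R) (q : quat R) (a : plane R -> quat R).

(* [q = u + j v] with [u, v] in C corresponds to [u + i v] and [u - i v]; in these two complex
   coordinates left multiplication by [expj] is diagonal. *)
Definition chi1 q : C := Complex (q.1.1 + q.2.2) (q.1.2 + q.2.1).
Definition chi2 q : C := Complex (q.1.1 - q.2.2) (q.1.2 - q.2.1).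

Lemma chi_inj q : chi1 q = 0 -> chi2 q = 0 -> q = 0.
Proof.
case: q => [[x0 x1] [x2 x3]] [/= a b] [/= c d].
by congr ((_, _), (_, _)); lra.
Qed.

Lemma chi1_rmul q l : chi1 (rmul q l) = chi1 q * l.
Proof.
by apply: complex_eq; case: q l => [[x0 x1] [x2 x3]] [l1 l2]; rewrite ?reM ?imM /=; ring.
Qed.

Lemma chi2_rmul q l : chi2 (rmul q l) = chi2 q * l.
Proof.
by apply: complex_eq; case: q l => [[x0 x1] [x2 x3]] [l1 l2]; rewrite ?reM ?imM /=; ring.
Qed.

(** [N] exchanges the two coordinates up to a phase. With [chi2_Nrm] this turns the quaternionic
    equation into the system for [P] and [Q]. *)
Lemma chi1_Nrm b0 z q :
  chi1 (qmul (Nrm b0 z) q) = I * cexp R (Complex 0 (beta b0 z)) * chi2 q.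
Proof.
apply: complex_eq; case: q => [[x0 x1] [x2 x3]];
  rewrite /Nrm /expj /cexp ?reM ?imM /= expR0; ring.
Qed.

Lemma chi2_Nrm b0 z q :
  chi2 (qmul (Nrm b0 z) q) = I * cexp R (Complex 0 (- beta b0 z)) * chi1 q.
Proof.
apply: complex_eq; case: q => [[x0 x1] [x2 x3]];
  rewrite /Nrm /expj /cexp ?reM ?imM /= expR0 cosN sinN; ring.
Qed.

Lemma chi1D q q' : chi1 (q + q') = chi1 q + chi1 q'.
Proof. by apply: complex_eq; rewrite ?reD ?imD /=; ring. Qed.

Lemma chi2D q q' : chi2 (q + q') = chi2 q + chi2 q'.
Proof. by apply: complex_eq; rewrite ?reD ?imD /=; ring. Qed.

Lemma chi1_0 : chi1 0 = 0. Proof. by apply: complex_eq; rewrite /= addr0. Qed.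

Lemma chi2_0 : chi2 0 = 0. Proof. by apply: complex_eq; rewrite /= subr0. Qed.

Lemma chi1_sum n (f : 'I_n -> quat R) : chi1 (\sum_(i < n) f i) = \sum_(i < n) chi1 (f i).
Proof. exact: (big_morph chi1 chi1D chi1_0). Qed.

Lemma chi2_sum n (f : 'I_n -> quat R) : chi2 (\sum_(i < n) f i) = \sum_(i < n) chi2 (f i).
Proof. exact: (big_morph chi2 chi2D chi2_0). Qed.

Lemma diff_dxdy a z (h : plane R) : differentiable a z ->
  'd a z h = h.1 *: dx a z + h.2 *: dy a z.
Proof.
move=> da; rewrite /dx /dy !deriveE // -!linearZ -linearD; congr ('d a z _).
by case: h => h1 h2; congr (_, _) => /=; rewrite scaler0 ?addr0 ?add0r [_%:A]mulr1.
Qed.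

Definition cell (w1 w2 : plane R) p : plane R := p.1 *: w1 + p.2 *: w2.

Lemma is_diff_cell w1 w2 p : is_diff p (cell w1 w2) (cell w1 w2).
Proof.
have comp (u v : R) : rdif R (fun q : plane R => q.1 * u + q.2 * v) p u v.
  apply: rdif_eq (rdifD _ _ _ _ _ _ _ _ (rdifM _ _ _ _ _ _ _ _ (rdif_fst _ p) (rdif_cst _ u p))
    (rdifM _ _ _ _ _ _ _ _ (rdif_snd _ p) (rdif_cst _ v p))) _ _ _ => //; ring.
exact: (is_diff_eq (is_diff_pair (comp w1.1 w2.1) (comp w1.2 w2.2))).
Qed.

Lemma is_diff_coord (F : plane R -> quat R) p (u v : quat R) :
  is_diff p F (fun h => h.1 *: u + h.2 *: v) ->
  [/\ rdif R (fun r => (F r).1.1) p u.1.1 v.1.1, rdif R (fun r => (F r).1.2) p u.1.2 v.1.2,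
      rdif R (fun r => (F r).2.1) p u.2.1 v.2.1 & rdif R (fun r => (F r).2.2) p u.2.2 v.2.2].
Proof.
move=> d.
have d1 := is_diff_comp d (is_diff_fst _ _ _ _).
have d2 := is_diff_comp d (is_diff_snd _ _ _ _).
split.
- exact: (is_diff_eq (is_diff_comp d1 (is_diff_fst _ _ _ _)) erefl).
- exact: (is_diff_eq (is_diff_comp d1 (is_diff_snd _ _ _ _)) erefl).
- exact: (is_diff_eq (is_diff_comp d2 (is_diff_fst _ _ _ _)) erefl).
- exact: (is_diff_eq (is_diff_comp d2 (is_diff_snd _ _ _ _)) erefl).
Qed.

Lemma cdif_chi (F : plane R -> quat R) p (u v : quat R) :
  is_diff p F (fun h => h.1 *: u + h.2 *: v) ->
  cdif R (fun r => chi1 (F r)) p (chi1 u) (chi1 v) /\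
  cdif R (fun r => chi2 (F r)) p (chi2 u) (chi2 v).
Proof.
move=> /is_diff_coord[d11 d12 d21 d22].
have N f x y : rdif R f p x y -> rdif R (fun r => - f r) p (- x) (- y).
  move=> df; apply: rdif_eq (rdifM _ _ _ _ _ _ _ _ (rdif_cst _ (-1) p) df) _ _ _ => [r||];
    by rewrite ?mulN1r // mul0r add0r.
split; split; [exact: rdifD d11 d22|exact: rdifD d12 d21|exact: rdifD d11 (N _ _ _ d22)|].
exact: rdifD d12 (N _ _ _ d21).
Qed.

Lemma chi1_comb (c d : R) q q' : chi1 (c *: q + d *: q') = c%:C%C * chi1 q + d%:C%C * chi1 q'.
Proof.
case: q q' => [[x0 x1] [x2 x3]] [[y0 y1] [y2 y3]].
by apply: complex_eq; rewrite ?reD ?imD ?reM ?imM /= /GRing.scale /=; ring.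
Qed.

Lemma chi2_comb (c d : R) q q' : chi2 (c *: q + d *: q') = c%:C%C * chi2 q + d%:C%C * chi2 q'.
Proof.
case: q q' => [[x0 x1] [x2 x3]] [[y0 y1] [y2 y3]].
by apply: complex_eq; rewrite ?reD ?imD ?reM ?imM /= /GRing.scale /=; ring.
Qed.

Lemma is_diff_cell_comp (w1 w2 : plane R) a p : differentiable a (cell w1 w2 p) ->
  is_diff p (fun r => a (cell w1 w2 r))
    (fun h => h.1 *: (w1.1 *: dx a (cell w1 w2 p) + w1.2 *: dy a (cell w1 w2 p))
            + h.2 *: (w2.1 *: dx a (cell w1 w2 p) + w2.2 *: dy a (cell w1 w2 p))).
Proof.
move=> da; apply: (is_diff_eq (is_diff_comp (is_diff_cell w1 w2 p) (differentiableP da))).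
apply/funext => h.
transitivity ((h.1 * w1.1 + h.2 * w2.1) *: dx a (cell w1 w2 p)
            + (h.1 * w1.2 + h.2 * w2.2) *: dy a (cell w1 w2 p)).
  exact: (diff_dxdy a _ (cell w1 w2 h) da).
by rewrite !scalerDl addrACA -!scalerA -!scalerDr.
Qed.

Lemma cell_surj (w1 w2 : plane R) z : lattice_basis w1 w2 -> exists p, cell w1 w2 p = z.
Proof.
rewrite /lattice_basis => D0.
exists ((w2.2 * z.1 - w2.1 * z.2) / (w1.1 * w2.2 - w1.2 * w2.1),
        (w1.1 * z.2 - w1.2 * z.1) / (w1.1 * w2.2 - w1.2 * w2.1)).
case: z => x y; congr (_, _).
  change ((w2.2 * x - w2.1 * y) / (w1.1 * w2.2 - w1.2 * w2.1) * w1.1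
    + (w1.1 * y - w1.2 * x) / (w1.1 * w2.2 - w1.2 * w2.1) * w2.1 = x :> R); by field.
change ((w2.2 * x - w2.1 * y) / (w1.1 * w2.2 - w1.2 * w2.1) * w1.2
  + (w1.1 * y - w1.2 * x) / (w1.1 * w2.2 - w1.2 * w2.1) * w2.2 = y :> R); by field.
Qed.

End QuaternionicSolutions.

(** * Fourier relations for holomorphic sections *)

Section DimensionBound.
Variable R : realType.
Local Notation C := R[i].
Local Notation I := (Complex (0 : R) 1).
Implicit Types (p z : plane R) (a : plane R -> quat R).

Lemma cexp_int (k : int) : cexp R (Complex 0 (2 * pi * k%:~R)) = 1.
Proof.
have nat_case (n : nat) : cexp R (Complex 0 (2 * pi * n%:R)) = 1.
  elim: n => [|n IH].
    by rewrite mulr0 -[RHS](cexp0 R); congr cexp.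
  rewrite (_ : Complex 0 _ = Complex 0 (2 * pi * n%:R) + Complex 0 (2 * pi)); last first.
    by apply: complex_eq; rewrite ?reD ?imD /= -?natr1; ring.
  rewrite cexpD IH mul1r; apply: complex_eq; rewrite /= expR0 mul1r mulr_natl.
    exact: cos2pi.
  exact: sin2pi.
case: k => n; first exact: nat_case.
have := cexpN R (Complex 0 (2 * pi * n.+1%:R)); rewrite nat_case mulr1 => <-.
by congr cexp; apply: complex_eq; rewrite /= ?oppr0 // NegzE mulrNz mulrN.
Qed.

Lemma cexp_freq (m : C) (k : int) : cexp R (m + Complex 0 (2 * pi * k%:~R)) = cexp R m.
Proof. by rewrite cexpD cexp_int mulr1. Qed.

Lemma twisted_periodic (F : plane R -> C) (m : C * C) :
  (forall p, F (p + (1, 0)) = F p * cexp R m.1) ->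
  (forall p, F (p + (0, 1)) = F p * cexp R m.2) ->
  forall p e, e = (1, 0) \/ e = (0, 1) ->
    mode R (- m) (p + e) * F (p + e) = mode R (- m) p * F p.
Proof.
move=> F1 F2 p e He.
case: He => ->.
  rewrite F1 (_ : mode R (- m) (p + (1, 0)) = mode R (- m) p * cexp R (- m.1)).
    by rewrite mulrACA (cexpN R m.1) mulr1.
  rewrite /mode -cexpD; congr cexp => /=.
  by apply: complex_eq; rewrite ?reD ?imD ?reM ?imM ?reD ?imD /=; ring.
rewrite F2 (_ : mode R (- m) (p + (0, 1)) = mode R (- m) p * cexp R (- m.2)).
  by rewrite mulrACA (cexpN R m.2) mulr1.
rewrite /mode -cexpD; congr cexp => /=.
by apply: complex_eq; rewrite ?reD ?imD ?reM ?imM ?reD ?imD /=; ring.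
Qed.

(** Since [b0] pairs integrally with the basis, [e^(i beta)] is itself a Fourier mode, and
    multiplication by it shifts frequencies by [freq n1 n2]. *)
Lemma mode_beta (w1 w2 b0 : plane R) (n1 n2 : int) p :
  dotP b0 w1 = n1%:~R -> dotP b0 w2 = n2%:~R ->
  cexp R (Complex 0 (beta b0 (cell R w1 w2 p))) = mode R (freq R n1 n2) p.
Proof.
move=> e1 e2; congr cexp; apply: complex_eq; rewrite ?reD ?imD ?reM ?imM /=; first by ring.
rewrite -e1 -e2 /beta /dotP /cell.
change (2 * pi * (b0.1 * (p.1 * w1.1 + p.2 * w2.1) + b0.2 * (p.1 * w1.2 + p.2 * w2.2)) =
  0 * 0 + 2 * pi * (b0.1 * w1.1 + b0.2 * w1.2) * p.1
  + (0 * 0 + 2 * pi * (b0.1 * w2.1 + b0.2 * w2.2) * p.2)); ring.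
Qed.

Lemma mode_betaN (w1 w2 b0 : plane R) (n1 n2 : int) p :
  dotP b0 w1 = n1%:~R -> dotP b0 w2 = n2%:~R ->
  cexp R (Complex 0 (- beta b0 (cell R w1 w2 p))) = mode R (- freq R n1 n2) p.
Proof.
move=> e1 e2; have := mode_beta w1 w2 b0 n1 n2 p e1 e2; rewrite /mode.
set x := beta _ _; set y := (X in _ = cexp R X) => e.
have -> : Complex 0 (- x) = - Complex 0 x by apply: complex_eq; rewrite /= ?oppr0.
have -> : (- freq R n1 n2).1 * (p.1)%:C%C + (- freq R n1 n2).2 * (p.2)%:C%C = - y.
  by rewrite /y opprD -!mulNr.
move: (Complex 0 x) y e => u v e.
by rewrite -[LHS]mulr1 -(mulfV (cexp_neq0 R v)) mulrA -{1}e cexpN mul1r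
  -[RHS]mulr1 -(mulfV (cexp_neq0 R v)) mulrA cexpN mul1r.
Qed.

Lemma cell_shift (w1 w2 : plane R) p (k1 k2 : int) :
  cell R w1 w2 (p + (k1%:~R, k2%:~R)) = cell R w1 w2 p + latpt w1 w2 k1 k2.
Proof.
by rewrite /cell /latpt /= !scalerDl addrACA.
Qed.

Lemma H0_shift w1 w2 b0 h a p (k1 k2 : int) : H0 w1 w2 b0 h a ->
  a (cell R w1 w2 (p + (k1%:~R, k2%:~R))) = rmul (a (cell R w1 w2 p)) (mult_val h k1 k2).
Proof. by move=> [_ ha]; rewrite cell_shift ha. Qed.

(** The phase couples the coefficient of [P] at [m] with that of [Q] at [m - freq n1 n2]; both
    covectors are logarithms of [h]. The conclusions are two uses of [mode_relation], with [P] and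
    [Q] exchanged. *)
Lemma H0_relation w1 w2 b0 h a (n1 n2 : int) (m : C * C) lP lQ :
  dotP b0 w1 = n1%:~R -> dotP b0 w2 = n2%:~R ->
  H0 w1 w2 b0 h a -> cexp R m.1 = h.1 -> cexp R m.2 = h.2 ->
  mean R (fun p => mode R (- m) p * chi1 R (a (cell R w1 w2 p))) lP ->
  mean R (fun p => mode R (- (m - freq R n1 n2)) p * chi2 R (a (cell R w1 w2 p))) lQ ->
  muy R w1 w2 m * lP = I * mux R w1 w2 (m - freq R n1 n2) * lQ /\
  muy R w1 w2 (m - freq R n1 n2) * lQ = I * mux R w1 w2 m * lP.
Proof.
move=> e1 e2 aH m1 m2 mP mQ; have [hol _] := aH.
have dA p := is_diff_cell_comp R w1 w2 a p (hol (cell R w1 w2 p)).1.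
have dP p := (cdif_chi _ _ _ _ _ (dA p)).1.
have dQ p := (cdif_chi _ _ _ _ _ (dA p)).2.
pose ax p := dx a (cell R w1 w2 p); pose ay p := dy a (cell R w1 w2 p).
have {}dP p : cdif R (fun r => chi1 R (a (cell R w1 w2 r))) p
    ((w1.1)%:C%C * chi1 R (ax p) + (w1.2)%:C%C * chi1 R (ay p))
    ((w2.1)%:C%C * chi1 R (ax p) + (w2.2)%:C%C * chi1 R (ay p)).
  by have d := dP p; rewrite !chi1_comb in d.
have {}dQ p : cdif R (fun r => chi2 R (a (cell R w1 w2 r))) p
    ((w1.1)%:C%C * chi2 R (ax p) + (w1.2)%:C%C * chi2 R (ay p))
    ((w2.1)%:C%C * chi2 R (ax p) + (w2.2)%:C%C * chi2 R (ay p)).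
  by have d := dQ p; rewrite !chi2_comb in d.
have sh1 p : a (cell R w1 w2 (p + (1, 0))) = rmul (a (cell R w1 w2 p)) h.1.
  by have := H0_shift _ _ _ _ _ p 1 0 aH; rewrite /mult_val expr1z expr0z mulr1.
have sh2 p : a (cell R w1 w2 (p + (0, 1))) = rmul (a (cell R w1 w2 p)) h.2.
  by have := H0_shift _ _ _ _ _ p 0 1 aH; rewrite /mult_val expr1z expr0z mul1r.
have c1 : cexp R (m - freq R n1 n2).1 = h.1.
  by rewrite -m1 -(cexp_freq _ n1) [X in cexp R X](_ : _ = m.1) // /= subrK.
have c2 : cexp R (m - freq R n1 n2).2 = h.2.
  by rewrite -m2 -(cexp_freq _ n2) [X in cexp R X](_ : _ = m.2) // /= subrK.
have perP : forall p e, e = (1, 0) \/ e = (0, 1) ->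
   mode R (- m) (p + e) * chi1 R (a (cell R w1 w2 (p + e)))
   = mode R (- m) p * chi1 R (a (cell R w1 w2 p)).
  apply: (twisted_periodic (fun p => chi1 R (a (cell R w1 w2 p)))) => p.
    by rewrite sh1 chi1_rmul m1.
  by rewrite sh2 chi1_rmul m2.
have perQ : forall p e, e = (1, 0) \/ e = (0, 1) ->
   mode R (- (m - freq R n1 n2)) (p + e) * chi2 R (a (cell R w1 w2 (p + e)))
   = mode R (- (m - freq R n1 n2)) p * chi2 R (a (cell R w1 w2 p)).
  apply: (twisted_periodic (fun p => chi2 R (a (cell R w1 w2 p)))) => p.
    by rewrite sh1 chi2_rmul c1.
  by rewrite sh2 chi2_rmul c2.
have md p : mode R (- (m - freq R n1 n2)) p = mode R (- m) p * mode R (freq R n1 n2) p.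
  by rewrite -modeD opprD opprK.
have mdN p : mode R (- m) p = mode R (- (m - freq R n1 n2)) p * mode R (- freq R n1 n2) p.
  by rewrite -modeD opprD opprK addrK.
split.
  apply: mode_relation dP dQ _ perP perQ mP mQ => p.
  rewrite /ay (hol (cell R w1 w2 p)).2.1 chi1_Nrm (mode_beta _ _ _ _ _ _ e1 e2) md; ring.
apply: mode_relation dQ dP _ perQ perP mQ mP => p.
rewrite /ay (hol (cell R w1 w2 p)).2.1 chi2_Nrm (mode_betaN _ _ _ _ _ _ e1 e2) [in RHS]mdN; ring.
Qed.

End DimensionBound.

(** * The dimension is at most the number of valid modes *)

Section DimensionCount.
Variable R : realType.
Local Notation C := R[i].
Implicit Types (p z : plane R) (a : plane R -> quat R).

Lemma cdif_sum n (F : 'I_n -> plane R -> C) p (u v : 'I_n -> C) :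
  (forall i, cdif R (F i) p (u i) (v i)) ->
  cdif R (fun r => \sum_(i < n) F i r) p (\sum_(i < n) u i) (\sum_(i < n) v i).
Proof.
move=> dF; elim: n F u v dF => [|n IH] F u v dF.
  rewrite !big_ord0; have -> : (fun r => \sum_(i < 0) F i r) = (fun=> 0).
    by apply/funext => r; rewrite big_ord0.
  exact: cdif_cst.
rewrite !big_ord_recl; have -> : (fun r => \sum_(i < n.+1) F i r)
    = (fun r => F ord0 r + \sum_(i < n) F (lift ord0 i) r).
  by apply/funext => r; rewrite big_ord_recl.
by apply: cdifD => //; apply: IH.
Qed.

Lemma mode_pick_sum (w1 w2 : plane R) m n (c lP lQ : 'I_n -> C) :
  \sum_(i < n) c i * mode_pick R w1 w2 m (lP i) (lQ i) =
  mode_pick R w1 w2 m (\sum_(i < n) c i * lP i) (\sum_(i < n) c i * lQ i).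
Proof. by rewrite /mode_pick; case: ifP. Qed.

(** After multiplication by [mode (- l)] the hypothesis concerns integer frequencies, so
    [fourier_uniq] applies in the open cell; quasiperiodicity does the rest. *)
Lemma fourier_vanish (V : plane R -> C) (l : C * C) (chi : int -> int -> C)
  (u v : plane R -> C) :
  (forall p, cdif R V p (u p) (v p)) ->
  (forall p k1 k2, V (p + (k1%:~R, k2%:~R)) = V p * chi k1 k2) ->
  (forall k1 k2, mean R (fun p => mode R (- (l + freq R k1 k2)) p * V p) 0) ->
  forall p, V p = 0.
Proof.
move=> dV per V0; apply: quasiperiodic_eq0 per _; first exact: cdif_ccts dV.
move=> s t s01 t01.
have dU p := cdifM _ _ _ _ _ _ _ _ (cdif_mode _ (- l) p) (dV p).
have U0 : forall k1 k2, mean R (fun p => mode R (freq R k1 k2) p * (mode R (- l) p * V p)) 0.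
  move=> k1 k2; apply: mean_eq (V0 (- k1) (- k2)) _ => p.
  rewrite mulrA -modeD; congr (mode R _ p * _); rewrite opprD addrC; congr (_ + _).
  by congr (_, _); apply: complex_eq; rewrite /= ?oppr0 // mulrNz mulrN opprK.
have := fourier_uniq _ _ s t (cdif_ccts _ _ _ _ dU) U0 s01 t01.
by move=> /eqP; rewrite mulf_eq0 (negPf (mode_neq0 _ _ _)) => /eqP.
Qed.

Lemma left_kernel n m (A : 'M[C]_(n, m)) : (m < n)%N ->
  exists c : 'I_n -> C, (exists i, c i != 0) /\ forall j, \sum_(i < n) c i * A i j = 0.
Proof.
move=> mn; have nz : nz_row (kermx A) != 0.
  rewrite nz_row_eq0 -mxrank_eq0 mxrank_ker subn_eq0 -ltnNge.
  by apply: leq_ltn_trans (rank_leq_col A) mn.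
exists (fun i => nz_row (kermx A) ord0 i); split.
  by have [i ?] := rV0Pn _ nz; exists i.
move=> j; have /sub_kermxP := nz_row_sub (kermx A).
by move=> /matrixP /(_ ord0 j); rewrite !mxE.
Qed.

(** A section is determined by its picked coefficients at the frequencies in [K]: if these vanish,
    so do all coefficients of [P] and [Q]. More than [size K] sections are therefore linearly
    dependent. *)
Lemma H0_dim_bound (w1 w2 b0 : plane R) (h : multiplier R) (n1 n2 : int) (l : C * C)
    (K : seq (int * int)) (d : nat) :
  lattice_basis w1 w2 -> freq R n1 n2 != 0 ->
  dotP b0 w1 = n1%:~R -> dotP b0 w2 = n2%:~R ->
  cexp R l.1 = h.1 -> cexp R l.2 = h.2 ->
  (forall k1 k2, valid_mode R w1 w2 (freq R n1 n2) (l + freq R k1 k2) -> (k1, k2) \in K) ->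
  (size K < d)%N -> ~ dimC_ge (H0 w1 w2 b0 h) d.
Proof.
move=> W n0 e1 e2 l1 l2 Kall Kd [a [aH indep]].
pose P i (r : plane R) := chi1 R (a i (cell R w1 w2 r)).
pose Q i (r : plane R) := chi2 R (a i (cell R w1 w2 r)).
have dPQ i p := cdif_chi _ _ _ _ _ (is_diff_cell_comp R w1 w2 (a i) p ((aH i).1 (cell R w1 w2 p)).1).
have dP i p : cdif R (P i) p _ _ := (dPQ i p).1.
have dQ i p : cdif R (Q i) p _ _ := (dPQ i p).2.
pose mk (k : int * int) := l + freq R k.1 k.2.
have exL (ik : 'I_d * (int * int)) : exists L : C * C,
    mean R (fun p => mode R (- mk ik.2) p * P ik.1 p) L.1 /\
    mean R (fun p => mode R (- (mk ik.2 - freq R n1 n2)) p * Q ik.1 p) L.2.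
  have d1 p := cdifM _ _ _ _ _ _ _ _ (cdif_mode _ (- mk ik.2) p) (dP ik.1 p).
  have d2 p := cdifM _ _ _ _ _ _ _ _ (cdif_mode _ (- (mk ik.2 - freq R n1 n2)) p) (dQ ik.1 p).
  have [x1 H1] := mean_ex _ _ (cdif_ccts _ _ _ _ d1).
  have [x2 H2] := mean_ex _ _ (cdif_ccts _ _ _ _ d2).
  by exists (x1, x2).
have [L LP] := choice exL.
pose A : 'M[C]_(d, size K) := \matrix_(i, j)
  (let k := nth (0, 0) K j in mode_pick R w1 w2 (mk k) (L (i, k)).1 (L (i, k)).2).
have [c [[i0 ci0] cA]] := left_kernel _ _ A Kd.
(* This holds for every [k]: in [K] by the choice of [c], elsewhere because the mode is not
   valid. *)
have LC k : \sum_(i < d) c i * (L (i, k)).1 = 0 /\ \sum_(i < d) c i * (L (i, k)).2 = 0.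
  have mk1 : cexp R (mk k).1 = h.1 by rewrite -l1; exact: cexp_freq.
  have mk2 : cexp R (mk k).2 = h.2 by rewrite -l2; exact: cexp_freq.
  have rel i := H0_relation _ _ _ _ _ _ _ _ _ _ _ e1 e2 (aH i) mk1 mk2 (LP (i, k)).1 (LP (i, k)).2.
  apply: (mode_pick_eq0 _ w1 w2 (freq R n1 n2) (mk k)) => //.
  - rewrite !mulr_sumr; apply: eq_bigr => i _.
    by rewrite mulrCA (rel i).1 mulrCA.
  - rewrite !mulr_sumr; apply: eq_bigr => i _.
    by rewrite mulrCA (rel i).2 mulrCA.
  - rewrite -mode_pick_sum => v; have := Kall k.1 k.2 v; rewrite -surjective_pairing => kK.
    have jK : (index k K < size K)%N by rewrite index_mem.
    have := cA (Ordinal jK); rewrite -[RHS](cA (Ordinal jK)) cA => _.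
    have := cA (Ordinal jK); under eq_bigr do rewrite mxE /= nth_index //.
    by [].
have per (x : 'I_d -> plane R -> C) : (forall i p k1 k2, x i (p + (k1%:~R, k2%:~R)) = x i p * mult_val h k1 k2) ->
    forall p k1 k2, \sum_(i < d) c i * x i (p + (k1%:~R, k2%:~R)) =
      (\sum_(i < d) c i * x i p) * mult_val h k1 k2.
  by move=> xs p k1 k2; rewrite mulr_suml; apply: eq_bigr => i _; rewrite xs mulrA.
have V1 p : \sum_(i < d) c i * P i p = 0.
  move: p; apply: (fourier_vanish _ l (mult_val h)).
  - by move=> p; apply: cdif_sum => i; apply: cdifZ; exact: dP.
  - by apply: per => i p k1 k2; rewrite /P (H0_shift _ _ _ _ _ _ _ _ _ (aH i)) chi1_rmul.
  move=> k1 k2; rewrite -[X in mean _ _ X](LC (k1, k2)).1.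
  apply: mean_eq (mean_sum _ _ _ _ _ (fun i => meanZ _ (c i) _ _ (LP (i, (k1, k2))).1)) _ => p /=.
  by rewrite mulr_sumr; apply: eq_bigr => i _; rewrite mulrCA.
have V2 p : \sum_(i < d) c i * Q i p = 0.
  move: p; apply: (fourier_vanish _ l (mult_val h)).
  - by move=> p; apply: cdif_sum => i; apply: cdifZ; exact: dQ.
  - by apply: per => i p k1 k2; rewrite /Q (H0_shift _ _ _ _ _ _ _ _ _ (aH i)) chi2_rmul.
  (* The second entry of [L] at index [k] belongs to the frequency of [k] minus that of [n], hence
     the shifted index. *)
  move=> k1 k2; rewrite -[X in mean _ _ X](LC (k1 + n1, k2 + n2)).2.
  apply: mean_eq (mean_sum _ _ _ _ _ (fun i => meanZ _ (c i) _ _ (LP (i, (k1 + n1, k2 + n2))).2)) _ => p /=.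
  have -> : mk (k1 + n1, k2 + n2) - freq R n1 n2 = l + freq R k1 k2.
    by rewrite /mk /= freqD addrA addrK.
  by rewrite mulr_sumr; apply: eq_bigr => i _; rewrite mulrCA.
have : c i0 = 0.
  apply: (indep c) => z; have [p <-] := cell_surj _ _ _ z W.
  apply: chi_inj.
    rewrite chi1_sum -[RHS](V1 p); apply: eq_bigr => i _.
    by rewrite chi1_rmul mulrC.
  rewrite chi2_sum -[RHS](V2 p); apply: eq_bigr => i _.
  by rewrite chi2_rmul mulrC.
by move=> e; rewrite e eqxx in ci0.
Qed.

End DimensionCount.

(** * Geometry of the valid modes, and their count by dual lattice points *)

Section ModeGeometry.
Variable R : realType.
Local Notation C := R[i].
Local Notation re := (@complex.Re R).
Local Notation im := (@complex.Im R).
Implicit Types (m : C * C) (k : int * int) (u v y d : plane R).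

Lemma plane_eq u v : u.1 = v.1 -> u.2 = v.2 -> u = v.
Proof. by case: u v => a b [c e] /= -> ->. Qed.

Lemma dotPC u v : dotP u v = dotP v u.
Proof. by rewrite /dotP mulrC [u.2 * _]mulrC. Qed.

Lemma dotPDl u v d : dotP (u + v) d = dotP u d + dotP v d.
Proof. by rewrite /dotP /= !mulrDl addrACA. Qed.

Lemma dotPZl (c : R) u d : dotP (c *: u) d = c * dotP u d.
Proof. by rewrite /dotP /= /GRing.scale /= mulrDr !mulrA. Qed.

(** Vectors orthogonal to a nonzero [y] have zero cross product, and [|v - u|^2 |v + u|^2] is the
    square of [|v|^2 - |u|^2] plus four times the squared cross product. *)
Lemma collinear_same_norm y u v : y != 0 -> dotP y u = 0 -> dotP y v = 0 ->
  dotP u u = dotP v v -> v = u \/ v = - u.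
Proof.
case: y u v => y1 y2 [u1 u2] [v1 v2]; rewrite /dotP /= => y0 yu yv uv.
have cross : u1 * v2 = u2 * v1.
  apply/eqP; rewrite -subr_eq0; move: y0; apply: contraNT => c0.
  have e1 : y1 * (u1 * v2 - u2 * v1) = 0.
    transitivity ((y1 * u1 + y2 * u2) * v2 - (y1 * v1 + y2 * v2) * u2); first by ring.
    by rewrite yu yv !mul0r subrr.
  have e2 : y2 * (u1 * v2 - u2 * v1) = 0.
    transitivity ((y1 * v1 + y2 * v2) * u1 - (y1 * u1 + y2 * u2) * v1); first by ring.
    by rewrite yu yv !mul0r subrr.
  move/eqP: e1; rewrite mulf_eq0 (negPf c0) orbF => /eqP ->.
  by move/eqP: e2; rewrite mulf_eq0 (negPf c0) orbF => /eqP ->.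
have : ((v1 - u1) ^+ 2 + (v2 - u2) ^+ 2) * ((v1 + u1) ^+ 2 + (v2 + u2) ^+ 2) = 0.
  transitivity ((v1 * v1 + v2 * v2 - (u1 * u1 + u2 * u2)) ^+ 2
    + 4 * (u1 * v2 - u2 * v1) ^+ 2); first by ring.
  by rewrite uv cross !subrr expr0n /= mulr0 addr0.
move/eqP; rewrite mulf_eq0 !paddr_eq0 ?sqr_ge0 // !sqrf_eq0 !subr_eq0 !addr_eq0.
by case/orP => /andP[/eqP -> /eqP ->]; [left|right].
Qed.

Definition wdet (w1 w2 : plane R) := w1.1 * w2.2 - w1.2 * w2.1.

(** Cramer's rule for the vector whose pairings with [w1] and [w2] are the entries of [k]; this
    parametrizes the dual lattice by pairs of integers. *)
Definition dvec (w1 w2 : plane R) k : plane R :=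
  ((w2.2 * k.1%:~R - w1.2 * k.2%:~R) / wdet w1 w2, (w1.1 * k.2%:~R - w2.1 * k.1%:~R) / wdet w1 w2).

Section Lattice.
Variables (w1 w2 b0 : plane R) (n : int * int).
Hypothesis W : lattice_basis w1 w2.
Hypothesis b0_neq0 : b0 != 0.
Hypothesis n1E : dotP b0 w1 = n.1%:~R.
Hypothesis n2E : dotP b0 w2 = n.2%:~R.
Local Notation dv := (dvec w1 w2).
Local Notation b := (freq R n.1 n.2).

Let D0 : wdet w1 w2 != 0. Proof. exact: W. Qed.

Lemma dotP_dvec1 k : dotP (dv k) w1 = k.1%:~R.
Proof. by rewrite /dotP /=; move: D0; rewrite /wdet => d0; field. Qed.

Lemma dotP_dvec2 k : dotP (dv k) w2 = k.2%:~R.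
Proof. by rewrite /dotP /=; move: D0; rewrite /wdet => d0; field. Qed.

Lemma dvec_uniq d k : dotP d w1 = k.1%:~R -> dotP d w2 = k.2%:~R -> d = dv k.
Proof.
rewrite /dvec => <- <-; move: D0; rewrite /dotP /wdet => d0.
by apply: plane_eq => /=; field.
Qed.

Lemma dvecD k k' : dv (k + k') = dv k + dv k'.
Proof. by apply/esym/dvec_uniq; rewrite dotPDl ?dotP_dvec1 ?dotP_dvec2 /= intrD. Qed.

Lemma dvecB k k' : dv (k - k') = dv k - dv k'.
Proof.
by apply/eqP; rewrite eq_sym subr_eq -dvecD subrK.
Qed.

Lemma dvec_inj : injective dv.
Proof.
move=> k k' e; have e1 := dotP_dvec1 k; have e2 := dotP_dvec2 k.
rewrite e dotP_dvec1 in e1; rewrite e dotP_dvec2 in e2.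
rewrite (surjective_pairing k) (surjective_pairing k').
by congr (_, _); apply/esym/(@intr_inj R).
Qed.

Lemma in_dualP d : in_dual w1 w2 d <-> exists k, d = dv k.
Proof.
split=> [dd|[k ->] g [k1 [k2 ->]]].
  have /intrP[k1 k1E] := dd _ (ex_intro _ 1 (ex_intro _ 0 erefl)).
  have /intrP[k2 k2E] := dd _ (ex_intro _ 0 (ex_intro _ 1 erefl)).
  exists (k1, k2); apply: dvec_uniq; rewrite /= -?k1E -?k2E /latpt.
    by rewrite scale1r scale0r addr0.
  by rewrite scale1r scale0r add0r.
rewrite (_ : dotP _ _ = k1%:~R * dotP (dv k) w1 + k2%:~R * dotP (dv k) w2); last first.
  by rewrite dotPC /latpt dotPDl !dotPZl !(dotPC _ (dv k)).
by rewrite dotP_dvec1 dotP_dvec2 rpredD // rpredM // intr_int.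
Qed.

Lemma b0E : b0 = dv n. Proof. exact: dvec_uniq. Qed.

Lemma dvec0 : dv 0 = 0.
Proof. by apply: plane_eq; rewrite /= !mulr0 subrr mul0r. Qed.

Lemma freq_neq0 : b != 0.
Proof.
apply: contra_neq b0_neq0; rewrite b0E -dvec0 => -[e1 e2]; congr dvec.
have p0 : 2 * pi != 0 :> R by rewrite mulf_neq0 // gt_eqF // pi_gt0.
have cancel (j : int) : 2 * pi * j%:~R = 0 :> R -> j = 0.
  by move/eqP; rewrite mulf_eq0 (negPf p0) intr_eq0 => /eqP.
by rewrite (surjective_pairing n) (cancel _ e1) (cancel _ e2).
Qed.

Lemma int_box (B : R) : exists s : seq int, forall j : int, `|j%:~R| <= B -> j \in s.
Proof.
pose N := (Num.truncn B).+1.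
exists ([seq i%:Z | i <- iota 0 N] ++ [seq - i%:Z | i <- iota 0 N]) => j jB.
have jN : (`|j| < N)%N.
  rewrite /N ltnS truncn_ge_nat; first by rewrite natr_absz intr_norm.
  by apply: le_trans jB; rewrite normr_ge0.
rewrite mem_cat; have [j0|/ltW j0] := leP 0 j.
  apply/orP; left; apply/mapP; exists `|j|%N; first by rewrite mem_iota.
  by rewrite gez0_abs.
apply/orP; right; apply/mapP; exists `|j|%N; first by rewrite mem_iota.
by rewrite lez0_abs // opprK.
Qed.

(** The entries of [k] are pairings of [dv k] with the basis, so a bound on its norm leaves finitely
    many [k]. *)
Lemma dvec_box (B : R) : exists s : seq (int * int),
  forall k, dotP (dv k) (dv k) <= B -> k \in s.
Proof.
have [s1 H1] := int_box ((1 + B) * (`|w1.1| + `|w1.2|)).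
have [s2 H2] := int_box ((1 + B) * (`|w2.1| + `|w2.2|)).
exists [seq (i, j) | i <- s1, j <- s2] => k kB.
(* The crude bound [|x| <= 1 + x^2] avoids square roots. *)
have bd (x z : R) : x * x + z * z <= B -> `|x| <= 1 + B.
  move=> xz; rewrite ler_norml.
  have := sqr_ge0 (x - 1); have := sqr_ge0 (x + 1); have := sqr_ge0 z; have := sqr_ge0 x.
  by rewrite !expr2; lra.
have b1 := bd _ _ kB; have b2 : `|(dv k).2| <= 1 + B by apply: (bd _ (dv k).1); rewrite addrC.
apply/allpairsP; exists k; split; last exact: surjective_pairing.
  apply: H1; rewrite -dotP_dvec1 /dotP; apply: le_trans (ler_normD _ _) _.
  by rewrite mulrDr (normrM (dv k).1) (normrM (dv k).2); apply: lerD; apply: ler_wpM2r.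
apply: H2; rewrite -dotP_dvec2 /dotP; apply: le_trans (ler_normD _ _) _.
by rewrite mulrDr (normrM (dv k).1) (normrM (dv k).2); apply: lerD; apply: ler_wpM2r.
Qed.

Lemma calD_enum : exists s : seq (plane R), uniq s /\ forall p, p \in s <-> in_calD w1 w2 b0 p.
Proof.
have [s sP] := dvec_box (dotP b0 b0).
exists (undup [seq dv k + (2^-1 : R) *: b0 | k <- s & dotP (dv k) (dv k) <= dotP b0 b0]).
split=> [|p]; first exact: undup_uniq.
have nrm d : (enorm d <= enorm b0) = (dotP d d <= dotP b0 b0).
  by rewrite /enorm ler_sqrt // /dotP -!expr2 addr_ge0 // sqr_ge0.
rewrite mem_undup; split=> [/mapP[k]|[[d [/in_dualP[k ->] ->]]]].
  rewrite mem_filter => /andP[kb _] ->; rewrite /in_calD addrK nrm; split => //.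
  by exists (dv k); split => //; apply/in_dualP; exists k.
by rewrite addrK nrm => kb; apply/mapP; exists k; rewrite // mem_filter kb sP.
Qed.

(* [mu m = y + i (u + pi D b0)], where [D = wdet w1 w2]. *)
Definition mode_re m : plane R := (re (mux R w1 w2 m), re (muy R w1 w2 m)).
Definition mode_im m : plane R :=
  (im (mux R w1 w2 m) - pi * wdet w1 w2 * b0.1, im (muy R w1 w2 m) - pi * wdet w1 w2 * b0.2).

Lemma mux_freq k : mux R w1 w2 (freq R k.1 k.2) = Complex 0 (2 * pi * wdet w1 w2 * (dv k).1).
Proof.
apply: complex_eq; rewrite /mux /freq /= ?reM ?imM; first by ring.
by move: D0; rewrite /wdet => d0; field.
Qed.

Lemma muy_freq k : muy R w1 w2 (freq R k.1 k.2) = Complex 0 (2 * pi * wdet w1 w2 * (dv k).2).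
Proof.
apply: complex_eq; rewrite /muy /freq /= ?reM ?imM; first by ring.
by move: D0; rewrite /wdet => d0; field.
Qed.

Lemma muxD m m' : mux R w1 w2 (m + m') = mux R w1 w2 m + mux R w1 w2 m'.
Proof. by rewrite /mux /=; ring. Qed.

Lemma muyD m m' : muy R w1 w2 (m + m') = muy R w1 w2 m + muy R w1 w2 m'.
Proof. by rewrite /muy /=; ring. Qed.

Lemma muxB m m' : mux R w1 w2 (m - m') = mux R w1 w2 m - mux R w1 w2 m'.
Proof. by rewrite /mux /=; ring. Qed.

Lemma muyB m m' : muy R w1 w2 (m - m') = muy R w1 w2 m - muy R w1 w2 m'.
Proof. by rewrite /muy /=; ring. Qed.

Lemma mode_reD m k : mode_re (m + freq R k.1 k.2) = mode_re m.
Proof. by rewrite /mode_re muxD muyD mux_freq muy_freq !reD /= !addr0. Qed.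

Lemma mode_imD m k :
  mode_im (m + freq R k.1 k.2) = mode_im m + (2 * pi * wdet w1 w2) *: dv k.
Proof.
rewrite /mode_im muxD muyD mux_freq muy_freq !imD.
by congr (_, _); rewrite /= addrAC.
Qed.

Local Notation rho := ((pi * wdet w1 w2) ^+ 2 * dotP b0 b0).

(** Centring makes the quadric symmetric: for [nu = y + i u] it reads [nu . nu + rho = 0], and the
    conclusions are its imaginary and real parts. *)
Lemma valid_modeE m : valid_mode R w1 w2 b m ->
  dotP (mode_re m) (mode_im m) = 0 /\
  dotP (mode_im m) (mode_im m) = dotP (mode_re m) (mode_re m) + rho.
Proof.
rewrite /valid_mode muxB muyB mux_freq muy_freq -b0E /mode_re /mode_im /dotP.
case: (mux R w1 w2 m) (muy R w1 w2 m) => y1 x1 [y2 x2].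
move: (wdet w1 w2) => D e.
have e1 := congr1 re e; have e2 := congr1 im e.
move: e1 e2; rewrite !reD !imD !reM !imM /= => e1 e2.
by split; apply/eqP; rewrite -subr_eq0; apply/eqP; [lra|lra].
Qed.

Let piD0 : 2 * pi * wdet w1 w2 != 0.
Proof. by rewrite !mulf_neq0 // gt_eqF // pi_gt0. Qed.

Lemma in_calD_dvec k : dotP (dv k) (dv k) <= dotP b0 b0 ->
  in_calD w1 w2 b0 (dv k + (2^-1 : R) *: b0).
Proof.
move=> kb; split; first by exists (dv k); split => //; apply/in_dualP; exists k.
by rewrite addrK /enorm ler_sqrt // /dotP -!expr2 addr_ge0 // sqr_ge0.
Qed.

(** For [y = 0] both vectors [u] have squared length [rho], so their difference, [2 pi D] times the
    dual vector, has squared length at most [4 rho]. *)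
Lemma valid_diff_bound l k k' : mode_re l = 0 ->
  valid_mode R w1 w2 b (l + freq R k.1 k.2) -> valid_mode R w1 w2 b (l + freq R k'.1 k'.2) ->
  dotP (dv (k - k')) (dv (k - k')) <= dotP b0 b0.
Proof.
move=> y0 /valid_modeE[_ v] /valid_modeE[_ v'].
have dE : (2 * pi * wdet w1 w2) *: dv (k - k') =
    mode_im (l + freq R k.1 k.2) - mode_im (l + freq R k'.1 k'.2).
  by rewrite dvecB scalerBr !mode_imD opprD addrACA subrr add0r.
have P : 0 < (2 * pi * wdet w1 w2) ^+ 2 by rewrite lt0r sqrf_eq0 piD0 sqr_ge0.
rewrite -(ler_pM2l P).
have -> : (2 * pi * wdet w1 w2) ^+ 2 * dotP (dv (k - k')) (dv (k - k')) =
   dotP ((2 * pi * wdet w1 w2) *: dv (k - k')) ((2 * pi * wdet w1 w2) *: dv (k - k')).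
  by rewrite dotPZl (dotPC (dv _)) dotPZl mulrA -expr2.
rewrite dE; rewrite mode_reD y0 in v; rewrite mode_reD y0 in v'.
move: v v'; move: (mode_im _) (mode_im (l + freq R k'.1 k'.2)) => u u' v v'.
have z0 : dotP (0 : plane R) 0 = 0 by rewrite /dotP /= mulr0 addr0.
rewrite z0 add0r in v v'.
have : dotP (u - u') (u - u') <= 2 * (dotP u u + dotP u' u').
  rewrite /dotP /=; have := sqr_ge0 (u.1 + u'.1); have := sqr_ge0 (u.2 + u'.2).
  by rewrite !expr2; lra.
by rewrite v v' => H; apply: le_trans H _; rewrite !exprMn; lra.
Qed.

(** The vectors [u] of all valid modes are orthogonal to the same nonzero [y] and equally long, so
    only two opposite values occur. *)
Lemma valid_three l k k' k'' : mode_re l != 0 ->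
  valid_mode R w1 w2 b (l + freq R k.1 k.2) -> valid_mode R w1 w2 b (l + freq R k'.1 k'.2) ->
  valid_mode R w1 w2 b (l + freq R k''.1 k''.2) -> k' != k -> k'' = k \/ k'' = k'.
Proof.
move=> y0 v v' v'' ne.
have inj (x z : int * int) :
    mode_im (l + freq R x.1 x.2) = mode_im (l + freq R z.1 z.2) -> x = z.
  rewrite !mode_imD => /addrI e; apply: dvec_inj.
  by apply: (scalerI piD0).
have [orth norm1] := valid_modeE _ v; have [orth' norm2] := valid_modeE _ v'.
have [orth'' norm3] := valid_modeE _ v''.
rewrite !mode_reD in orth norm1 orth' norm2 orth'' norm3.
have [/inj e|e'] := collinear_same_norm _ _ _ y0 orth orth' (etrans norm1 (esym norm2)).
  by rewrite e eqxx in ne.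
have [/inj e|e''] := collinear_same_norm _ _ _ y0 orth orth'' (etrans norm1 (esym norm3)).
  by left.
by right; apply: inj; rewrite e' e''.
Qed.

(** For [y = 0] the differences to one fixed valid frequency inject into the points of the disk.
    Otherwise at most two frequencies are valid, and the disk contains at least two points. *)
Lemma valid_count (l : C * C) (s : seq (plane R)) : uniq s -> (forall p, p \in s <-> in_calD w1 w2 b0 p) ->
  exists K : seq (int * int), (size K <= size s)%N /\
    forall k1 k2 : int, valid_mode R w1 w2 b (l + freq R k1 k2) -> (k1, k2) \in K.
Proof.
move=> us sP.
have [[k vk]|nov] := pselect (exists k : int * int,
    valid_mode R w1 w2 b (l + freq R k.1 k.2)); last first.
  by exists [::]; split => // k1 k2 v; case: nov; exists (k1, k2).
have [y0|y0] := eqVneq (mode_re l) 0.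
  (* The inverse of that injection: the pairings of [p] minus [b0 / 2] are integers, which [floor]
     recovers. *)
  exists [seq ((Num.floor (dotP (p - (2^-1 : R) *: b0) w1) + k.1)%R,
               (Num.floor (dotP (p - (2^-1 : R) *: b0) w2) + k.2)%R) | p <- s].
  split; first by rewrite size_map.
  move=> k1 k2 v; have vd := valid_diff_bound _ (k1, k2) k y0 v vk.
  apply/mapP; exists (dv ((k1, k2) - k) + (2^-1 : R) *: b0); first exact/sP/in_calD_dvec.
  by rewrite addrK dotP_dvec1 dotP_dvec2 !intrKfloor /= !subrK.
have [[k' [vk' ne]]|one] := pselect (exists k' : int * int,
    valid_mode R w1 w2 b (l + freq R k'.1 k'.2) /\ k' != k).
  exists [:: k; k']; split; last first.
    move=> k1 k2 v; rewrite !inE.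
    by have [<-|<-] := valid_three _ _ _ (k1, k2) y0 vk vk' v ne; rewrite eqxx ?orbT.
  (* The dual vectors 0 and [b0] always give two distinct points of the disk. *)
  have -> : size [:: k; k'] = size [:: dv 0 + (2^-1 : R) *: b0; dv n + (2^-1 : R) *: b0] by [].
  apply: uniq_leq_size => [|p].
    rewrite /= inE andbT (inj_eq (addIr _)); apply: contra_neq b0_neq0 => e.
    by rewrite b0E -e dvec0.
  rewrite !inE => /orP[] /eqP ->; apply/sP/in_calD_dvec; last by rewrite -b0E.
  by rewrite dvec0 /dotP /= mulr0 addr0 -!expr2 addr_ge0 // sqr_ge0.
exists [:: k]; split.
  apply: (@uniq_leq_size _ [:: dv 0 + (2^-1 : R) *: b0]) => // p.
  rewrite !inE => /eqP ->; apply/sP/in_calD_dvec.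
  by rewrite dvec0 /dotP /= mulr0 addr0 -!expr2 addr_ge0 // sqr_ge0.
move=> k1 k2 v; rewrite inE; apply: contrapT => /negP ne; apply: one.
by exists (k1, k2).
Qed.

End Lattice.
End ModeGeometry.

(** * Discreteness of the multipliers with two valid modes *)

Section Resonances.
Variable R : realType.
Local Notation C := R[i].
Local Notation re := (@complex.Re R).
Local Notation im := (@complex.Im R).

Lemma cexp_norm (z : C) : `|cexp R z| = (expR (re z))%:C%C.
Proof.
by rewrite normc_def /= !exprMn -mulrDr cos2Dsin2 mulr1 sqrtr_sqr ger0_norm // expR_ge0.
Qed.

Lemma cexp_surj (z : C) : z != 0 -> exists m, cexp R m = z.
Proof.
case: z => x y nz.
have n0 : 0 < x ^+ 2 + y ^+ 2.
  rewrite lt0r addr_ge0 ?sqr_ge0 // andbT paddr_eq0 ?sqr_ge0 // !sqrf_eq0.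
  by apply: contra nz => /andP[/eqP -> /eqP ->].
set r := Num.sqrt (x ^+ 2 + y ^+ 2).
have r0 : 0 < r by rewrite sqrtr_gt0.
have r2 : r ^+ 2 = x ^+ 2 + y ^+ 2 by rewrite sqr_sqrtr // ltW.
have xr : -1 <= x / r <= 1.
  rewrite -ler_norml normrM normfV (gtr0_norm r0) ler_pdivrMr // mul1r.
  have : `|x| ^+ 2 <= r ^+ 2 by rewrite r2 real_normK ?num_real // lerDl sqr_ge0.
  by rewrite ler_pXn2r // nnegrE ltW.
have sinE : Num.sqrt (1 - (x / r) ^+ 2) = `|y| / r.
  have -> : 1 - (x / r) ^+ 2 = (y / r) ^+ 2.
    rewrite !expr_div_n r2; field; by rewrite gt_eqF.
  by rewrite sqrtr_sqr normrM normfV (gtr0_norm r0).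
pose t := if 0 <= y then acos (x / r) else - acos (x / r).
exists (Complex (ln r) t); rewrite /cexp /= lnK ?posrE //.
have ct : cos t = x / r.
  by rewrite /t; case: ifP => _; rewrite ?cosN acosK // in_itv.
have st : sin t = y / r.
  rewrite /t; case: ifP => y0; rewrite ?sinN sin_acos // sinE.
    by rewrite ger0_norm.
  by rewrite ltr0_norm ?mulNr ?opprK // ltNge y0.
by rewrite ct st; congr Complex; rewrite mulrC divfK // gt_eqF.
Qed.

(** The threshold is half of [|e^z|]: the two moduli then differ at most by a factor 2, which is
    below [e]. *)
Lemma cexp_close (z z' : C) :
  `|cexp R z' - cexp R z| < (expR (re z) / 2)%:C%C -> `|re z' - re z| <= 1.
Proof.
move=> zz; have e2 : (2 : R) <= expR 1 by apply: le_trans (expR_ge1Dx 1); lra.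
have E0 := expR_gt0 (re z); have E0' := expR_gt0 (re z').
have h1 : expR (re z') - expR (re z) < expR (re z) / 2.
  by rewrite -ltcR rmorphB /= -!cexp_norm; apply: le_lt_trans (lerB_dist _ _) zz.
have h2 : expR (re z) - expR (re z') < expR (re z) / 2.
  rewrite -ltcR rmorphB /= -!cexp_norm; apply: le_lt_trans (lerB_dist _ _) _.
  by rewrite distrC.
have l1 : expR (re z' - re z) <= expR 1.
  apply: le_trans e2; rewrite expRB ler_pdivrMr //; lra.
have l2 : expR (re z - re z') <= expR 1.
  apply: le_trans e2; rewrite expRB ler_pdivrMr //; lra.
by rewrite !ler_expR in l1 l2; rewrite ler_norml; lra.
Qed.

Lemma seq_separated (s : seq (multiplier R)) (h : multiplier R) : exists2 d : R, 0 < d &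
  forall h', h' \in s -> `|h'.1 - h.1| < d%:C%C -> `|h'.2 - h.2| < d%:C%C -> h' = h.
Proof.
have pos (z : C) : z != 0 -> exists2 d : R, 0 < d & ~~ (`|z| < d%:C%C).
  move=> z0; exists (re `|z|); last first.
    by rewrite normc_def /= ltxx.
  have := z0; rewrite -normr_gt0 normc_def /=.
  by rewrite -(rmorph0 (real_complex R)) ltcR.
elim: s => [|x s [d d0 dP]]; first by exists 1.
have [e e0 eP] : exists2 e : R, 0 < e &
    (`|x.1 - h.1| < e%:C%C -> `|x.2 - h.2| < e%:C%C -> x = h).
  have [e1|n1] := eqVneq x.1 h.1; last first.
    have [|e e0 /negP eP] := pos (x.1 - h.1); first by rewrite subr_eq0.
    by exists e.
  have [e2|n2] := eqVneq x.2 h.2; last first.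
    have [|e e0 /negP eP] := pos (x.2 - h.2); first by rewrite subr_eq0.
    by exists e.
  by exists 1 => // _ _; rewrite (surjective_pairing x) e1 e2 -surjective_pairing.
exists (Num.min d e); first by rewrite lt_min d0.
have md : (Num.min d e)%:C%C <= d%:C%C :> C by rewrite lecR ge_min lexx.
have me : (Num.min d e)%:C%C <= e%:C%C :> C by rewrite lecR ge_min lexx orbT.
move=> h'; rewrite inE => /orP[/eqP -> l1 l2|hs l1 l2].
  by apply: eP; [exact: lt_le_trans l1 me|exact: lt_le_trans l2 me].
by apply: dP => //; [exact: lt_le_trans l1 md|exact: lt_le_trans l2 md].
Qed.

(** One of [x] and [t] vanishes and the sign of [c] tells which; the maxima treat both cases at
    once, with a single sign left free. *)
Lemma sign_split (x t c : R) : t * x = 0 -> x ^+ 2 - t ^+ 2 = c -> exists e : bool,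
  x = (-1) ^+ e * Num.sqrt (Num.max c 0) /\ t = (-1) ^+ e * Num.sqrt (Num.max (- c) 0).
Proof.
have sgE (z : R) : z = (-1) ^+ (z < 0)%R * `|z|.
  by case: ltP => z0; [rewrite expr1 mulN1r ltr0_norm ?opprK|rewrite expr0 mul1r ger0_norm].
have e0 (e : bool) : (-1) ^+ e * Num.sqrt (0 : R) = 0 by rewrite sqrtr0 mulr0.
move=> /eqP; rewrite mulf_eq0 => /orP[/eqP -> <-|/eqP -> <-].
  exists (x < 0); rewrite expr0n /= subr0 (max_l (sqr_ge0 _)) sqrtr_sqr -sgE; split => //.
  by rewrite max_r ?e0 // oppr_le0 sqr_ge0.
exists (t < 0); rewrite expr0n /= sub0r opprK (max_l (sqr_ge0 _)) sqrtr_sqr -sgE; split => //.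
by rewrite max_r ?e0 // oppr_le0 sqr_ge0.
Qed.

Section Lattice.
Variables (w1 w2 b0 : plane R) (n : int * int).
Hypothesis W : lattice_basis w1 w2.
Hypothesis b0_neq0 : b0 != 0.
Hypothesis n1E : dotP b0 w1 = n.1%:~R.
Hypothesis n2E : dotP b0 w2 = n.2%:~R.
Local Notation dv := (dvec R w1 w2).
Local Notation b := (freq R n.1 n.2).
Local Notation yv := (mode_re R w1 w2).
Local Notation uv := (mode_im R w1 w2 b0).
Local Notation q := (2 * pi * wdet R w1 w2).
Local Notation rho := ((pi * wdet R w1 w2) ^+ 2 * dotP b0 b0).

(** The exceptional set: multipliers with two distinct valid logarithms. For every other one
    [H0_dim_bound] applies with a single frequency. *)
Definition resonant (h : multiplier R) : Prop := exists (m : C * C) (k : int * int),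
  [/\ k != 0, h = (cexp R m.1, cexp R m.2), valid_mode R w1 w2 b m &
      valid_mode R w1 w2 b (m + freq R k.1 k.2)].

Definition perp (v : plane R) : plane R := (- v.2, v.1).

(** With [v = q dv k], [u = - v / 2 + x perp v] and [y = t perp v], this is the value that the norm
    relation imposes on [x^2 - t^2]. *)
Definition amp (k : int * int) : R := rho / dotP (q *: dv k) (q *: dv k) - 4^-1.

Lemma mode_det m m' : uv m = uv m' -> yv m = yv m' -> m = m'.
Proof.
rewrite /mode_im /mode_re => -[/addIr u1 /addIr u2] [y1 y2].
apply/eqP; rewrite -subr_eq0; apply/eqP; apply: (mu_eq0 R w1 w2) => //.
  by rewrite muxB; apply/eqP; rewrite subr_eq0; apply/eqP/complex_eq.
by rewrite muyB; apply/eqP; rewrite subr_eq0; apply/eqP/complex_eq.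
Qed.

Let q0 : q != 0.
Proof. by rewrite !mulf_neq0 // gt_eqF // pi_gt0. Qed.

Lemma dotP_gt0 (v : plane R) : v != 0 -> 0 < dotP v v.
Proof.
rewrite /dotP -!expr2 => v0; rewrite lt0r addr_ge0 ?sqr_ge0 // andbT paddr_eq0 ?sqr_ge0 //.
rewrite !sqrf_eq0; apply: contra v0 => /andP[/eqP e1 /eqP e2].
by apply/eqP/plane_eq.
Qed.

Lemma qdvec_neq0 k : k != 0 -> q *: dv k != 0.
Proof.
move=> k0; rewrite scaler_eq0 (negPf q0) /=; apply: contra_neq k0 => e.
by apply: (dvec_inj R w1 w2 W); rewrite e dvec0.
Qed.

(** The last two conclusions come from subtracting the equations at [u] and at [u + q dv k]; [y] is
    common to both. *)
Lemma resonant_relations m k : valid_mode R w1 w2 b m ->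
  valid_mode R w1 w2 b (m + freq R k.1 k.2) ->
  [/\ dotP (yv m) (uv m) = 0, dotP (uv m) (uv m) = dotP (yv m) (yv m) + rho,
      dotP (yv m) (q *: dv k) = 0 &
      2 * dotP (uv m) (q *: dv k) = - dotP (q *: dv k) (q *: dv k)].
Proof.
move=> /(valid_modeE _ _ _ _ _ W n1E n2E)[yu e1] /(valid_modeE _ _ _ _ _ W n1E n2E)[].
rewrite mode_reD // mode_imD // dotPC dotPDl dotPC yu add0r dotPC => yk e2.
split => //; move: e2; rewrite -e1; move: (uv m) (q *: dv k) => u v.
rewrite dotPDl !(dotPC _ _ (u + v)) !dotPDl (dotPC _ v u) => e.
by lra.
Qed.

(** In the orthogonal basis [v = q dv k], [perp v] the relations fix the components along [v]; the
    others satisfy [t x = 0] and [x^2 - t^2 = amp k]. So [k] and one sign determine [m]. *)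
Lemma resonant_form m k : k != 0 -> valid_mode R w1 w2 b m ->
  valid_mode R w1 w2 b (m + freq R k.1 k.2) -> exists e : bool,
  uv m = (- 2^-1 : R) *: (q *: dv k)
       + ((-1) ^+ e * Num.sqrt (Num.max (amp k) 0)) *: perp (q *: dv k) /\
  yv m = ((-1) ^+ e * Num.sqrt (Num.max (- amp k) 0)) *: perp (q *: dv k).
Proof.
move=> k0 v v'; have [yu uu yk uk] := resonant_relations m k v v'.
rewrite /amp; have := dotP_gt0 _ (qdvec_neq0 _ k0).
move: (uv m) (yv m) (q *: dv k) yu uu yk uk => [u1 u2] [y1 y2] [k1 k2].
rewrite /perp /dotP /=; set N := k1 * k1 + k2 * k2 => yu uu yk uk N0.
have Nn : N != 0 by rewrite gt_eqF.
pose x := (u2 * k1 - u1 * k2) / N; pose t := (y2 * k1 - y1 * k2) / N.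
have yt1 : y1 = t * - k2.
  rewrite /t; apply: (mulIf Nn); rewrite mulrAC divfK //.
  apply/eqP; rewrite -subr_eq0; apply/eqP.
  transitivity ((y1 * k1 + y2 * k2) * k1); first by rewrite /N; ring.
  by rewrite yk mul0r.
have yt2 : y2 = t * k1.
  rewrite /t; apply: (mulIf Nn); rewrite mulrAC divfK //.
  apply/eqP; rewrite -subr_eq0; apply/eqP.
  transitivity ((y1 * k1 + y2 * k2) * k2); first by rewrite /N; ring.
  by rewrite yk mul0r.
have uk' : u1 * k1 + u2 * k2 = - 2^-1 * N by lra.
have ux1 : u1 = - 2^-1 * k1 + x * - k2.
  rewrite /x; apply: (mulIf Nn); rewrite mulrDl [- 2^-1 * k1 * N]mulrAC -uk'.
  by rewrite [_ / N * _ * N]mulrAC divfK // /N; ring.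
have ux2 : u2 = - 2^-1 * k2 + x * k1.
  rewrite /x; apply: (mulIf Nn); rewrite mulrDl [- 2^-1 * k2 * N]mulrAC -uk'.
  by rewrite [_ / N * _ * N]mulrAC divfK // /N; ring.
clearbody x t.
have tx : t * x = 0.
  apply: (mulIf Nn); rewrite mul0r -yu ux1 ux2 yt1 yt2 /N; ring.
have c : x ^+ 2 - t ^+ 2 = rho / N - 4^-1.
  apply: (mulIf Nn); rewrite mulrBl mulrBl divfK //.
  move: uu; rewrite ux1 ux2 yt1 yt2 => uu.
  apply/eqP; rewrite -subr_eq0; apply/eqP.
  transitivity ((- 2^-1 * k1 + x * - k2) * (- 2^-1 * k1 + x * - k2)
    + (- 2^-1 * k2 + x * k1) * (- 2^-1 * k2 + x * k1)
    - (t * - k2 * (t * - k2) + t * k1 * (t * k1) + (pi * wdet R w1 w2) ^+ 2 * (b0.1 * b0.1 + b0.2 * b0.2))).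
    by rewrite /N /dotP; field.
  by rewrite uu subrr.
have [e []] := sign_split x t _ tx c; rewrite /dotP => ex et.
by exists e; rewrite -ex -et; split; apply: plane_eq.
Qed.

(** With [v = q dv k], the relation [2 u . v = - |v|^2] gives [|2 u + v|^2 = 4 |u|^2 - |v|^2], which
    is nonnegative. *)
Lemma resonant_bound m k : valid_mode R w1 w2 b m ->
  valid_mode R w1 w2 b (m + freq R k.1 k.2) ->
  dotP (dv k) (dv k) <= 4 * (dotP (yv m) (yv m) + rho) / q ^+ 2.
Proof.
move=> v v'; have [_ <- _ uk] := resonant_relations m k v v'.
have P : 0 < q ^+ 2 by rewrite lt0r sqrf_eq0 q0 sqr_ge0.
rewrite ler_pdivlMr // mulrC.
have -> : q ^+ 2 * dotP (dv k) (dv k) = dotP (q *: dv k) (q *: dv k).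
  by rewrite dotPZl (dotPC _ (dv _)) dotPZl mulrA -expr2.
move: (uv m) (q *: dv k) uk => u z uk.
have : 0 <= dotP (2 *: u + z) (2 *: u + z) by rewrite /dotP -!expr2 addr_ge0 // sqr_ge0.
have -> : dotP (2 *: u + z) (2 *: u + z) = 4 * dotP u u + 4 * dotP u z + dotP z z.
  by rewrite !(dotPDl, dotPZl, dotPC _ _ (_ + _), dotPC _ _ (_ *: _)) (dotPC _ z u); ring.
by lra.
Qed.

(** Cauchy-Schwarz, with the defect written as a sum of two squares. The real parts of [m] are the
    logarithms of the moduli of the multiplier. *)
Lemma mode_re_bound (m : C * C) A : `|re m.1| <= A -> `|re m.2| <= A ->
  dotP (yv m) (yv m) <= (dotP w1 w1 + dotP w2 w2) * (2 * A ^+ 2).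
Proof.
case: m => [[a1 c1] [a2 c2]] /= h1 h2.
have s1 : a1 ^+ 2 <= A ^+ 2.
  by rewrite -real_normK ?num_real // lerXn2r ?nnegrE ?normr_ge0 ?(le_trans _ h1).
have s2 : a2 ^+ 2 <= A ^+ 2.
  by rewrite -[a2 ^+ 2]real_normK ?num_real // lerXn2r ?nnegrE ?normr_ge0 ?(le_trans _ h2).
have w0 : 0 <= dotP w1 w1 + dotP w2 w2 by rewrite !addr_ge0 // -expr2 sqr_ge0.
apply: (@le_trans _ _ ((dotP w1 w1 + dotP w2 w2) * (a1 ^+ 2 + a2 ^+ 2))); last first.
  by apply: ler_wpM2l => //; rewrite mulr_natl mulr2n lerD.
rewrite /mode_re /mux /muy /dotP /= -subr_ge0 !mul0r !subr0.
rewrite [X in 0 <= X](_ : _ = (w2.2 * a2 + w1.2 * a1) ^+ 2 + (w1.1 * a1 + w2.1 * a2) ^+ 2).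
  by rewrite addr_ge0 // sqr_ge0.
by ring.
Qed.

(** Near [h] the real parts of logarithms are bounded, so [k] lies in a finite box; each [k] with a
    sign yields at most one multiplier. Hence only finitely many resonant multipliers lie near
    [h]. *)
Lemma resonant_discrete : discrete_set resonant.
Proof.
move=> h [m [k [k0 hE v v']]].
(* [g] is the multiplier of the mode with this index and sign, or the default [(1, 1)] if there is
   none. *)
have exG (ke : (int * int) * bool) : exists g : multiplier R, forall m : C * C,
    uv m = (- 2^-1 : R) *: (q *: dv ke.1)
       + ((-1) ^+ ke.2 * Num.sqrt (Num.max (amp ke.1) 0)) *: perp (q *: dv ke.1) ->
    yv m = ((-1) ^+ ke.2 * Num.sqrt (Num.max (- amp ke.1) 0)) *: perp (q *: dv ke.1) ->
    (cexp R m.1, cexp R m.2) = g.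
  have [[m0 [u0 y0]]|no] := pselect (exists m0 : C * C,
    uv m0 = (- 2^-1 : R) *: (q *: dv ke.1)
       + ((-1) ^+ ke.2 * Num.sqrt (Num.max (amp ke.1) 0)) *: perp (q *: dv ke.1) /\
    yv m0 = ((-1) ^+ ke.2 * Num.sqrt (Num.max (- amp ke.1) 0)) *: perp (q *: dv ke.1)).
    exists (cexp R m0.1, cexp R m0.2) => m' u' y'.
    by rewrite (mode_det m' m0) // ?u' ?y'.
  by exists (1, 1) => m' u' y'; case: no; exists m'.
have [G GP] := choice exG.
(* [A] bounds the real parts of every [m'] whose real parts are within 1 of those of [m]. *)
pose A := `|re m.1| + `|re m.2| + 1.
have [box boxP] := dvec_box R w1 w2 W
  (4 * ((dotP w1 w1 + dotP w2 w2) * (2 * A ^+ 2) + rho) / q ^+ 2).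
have [d d0 dP] := seq_separated [seq G (j, e) | j <- box, e <- [:: true; false]] h.
pose eps := Num.min d (Num.min (expR (re m.1) / 2) (expR (re m.2) / 2)).
exists (eps%:C%C); split.
  by rewrite -(rmorph0 (real_complex R)) ltcR !lt_min d0 !divr_gt0 ?expR_gt0.
have [le1 [le2 le3]] : eps%:C%C <= d%:C%C :> C /\
    (eps%:C%C <= (expR (re m.1) / 2)%:C%C :> C /\ eps%:C%C <= (expR (re m.2) / 2)%:C%C :> C).
  by rewrite !lecR /eps !ge_min !lexx ?orbT.
move=> h' [m' [k' [k0' hE' w w']]] c1 c2.
apply: dP; [|exact: lt_le_trans c1 le1|exact: lt_le_trans c2 le1].
rewrite hE hE' /= in c1 c2.
have r1 := cexp_close _ _ (lt_le_trans c1 le2).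
have r2 := cexp_close _ _ (lt_le_trans c2 le3).
have [e [ue ye]] := resonant_form m' k' k0' w w'.
rewrite hE' (GP (k', e) m' ue ye); apply: allpairs_f; last by case: (e).
apply: boxP; apply: le_trans (resonant_bound _ _ w w') _.
have P : 0 < q ^+ 2 by rewrite lt0r sqrf_eq0 q0 sqr_ge0.
rewrite ler_pM2r ?invr_gt0 // ler_pM2l // lerD2r; apply: mode_re_bound.
  rewrite -(subrK (re m.1) (re m'.1)); apply: le_trans (ler_normD _ _) _.
  by rewrite /A; have := normr_ge0 (re m.2); lra.
rewrite -(subrK (re m.2) (re m'.2)); apply: le_trans (ler_normD _ _) _.
by rewrite /A; have := normr_ge0 (re m.1); lra.
Qed.

End Lattice.
End Resonances.

(** * Four independent sections for the trivial multiplier *)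

Section TrivialMultiplier.
Variable R : realType.
Local Notation C := R[i].
Implicit Types (a : plane R -> quat R) (x y q : quat R) (z : plane R).

Lemma quat_eq x y : x.1.1 = y.1.1 -> x.1.2 = y.1.2 -> x.2.1 = y.2.1 -> x.2.2 = y.2.2 -> x = y.
Proof.
by case: x y => [[x0 x1] [x2 x3]] [[y0 y1] [y2 y3]] /= -> -> -> ->.
Qed.

Lemma qmulA x y q : qmul x (qmul y q) = qmul (qmul x y) q.
Proof. by apply: quat_eq; rewrite /=; ring. Qed.

Lemma qmul0 x : qmul x 0 = 0.
Proof. by apply: quat_eq; rewrite /= !mulr0 !(addr0, subr0). Qed.

Lemma rmul1 x : rmul x 1 = x.
Proof. by case: x => [[x0 x1] [x2 x3]]; apply: quat_eq; rewrite /=; ring. Qed.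

Lemma Nrm_sqr b0 z x : qmul (Nrm b0 z) (qmul (Nrm b0 z) x) = - x.
Proof.
have cs := cos2Dsin2 (beta b0 z).
have scale (r : R) : r = (cos (beta b0 z) ^+ 2 + sin (beta b0 z) ^+ 2) * r by rewrite cs mul1r.
case: x => [[x0 x1] [x2 x3]].
apply: quat_eq; rewrite /= [RHS]scale; ring.
Qed.

(** The second equation follows from the first, as [N] squares to -1. *)
Lemma holomorphicP b0 a : (forall z, differentiable a z) ->
  (forall z, dy a z = qmul (Nrm b0 z) (dx a z)) -> holomorphic b0 a.
Proof. by move=> da e z; split => //; split; rewrite e ?Nrm_sqr. Qed.

Lemma holomorphic_cst b0 q : holomorphic b0 (fun=> q).
Proof.
apply: holomorphicP => z; first exact: differentiable_cst.
by rewrite /dx /dy !derive_cst qmul0.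
Qed.

(** Since [i] anticommutes with [j], moving it across [e^(j beta / 2)] inverts that factor. This
    makes [f] holomorphic. *)
Lemma Nrm_half b0 z :
  qmul (Nrm b0 z) (expj (beta b0 z / 2)) = qmul (expj (beta b0 z / 2)) (Qi R).
Proof.
rewrite /Nrm {1}[beta b0 z]splitr; set t := beta b0 z / 2.
have c : cos (t + t) * cos t + sin (t + t) * sin t = cos t by rewrite -cosB addrK.
have s : sin (t + t) * cos t - cos (t + t) * sin t = sin t by rewrite -sinB addrK.
apply: quat_eq; rewrite /=.
- by ring.
- by rewrite -[in RHS]c; ring.
- by ring.
- by rewrite -[in RHS]s; ring.
Qed.

Lemma qmul_Qj x : qmul x (Qj R) = (- x.2, x.1).
Proof. by case: x => [[x0 x1] [x2 x3]]; apply: quat_eq; rewrite /=; ring. Qed.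

Lemma is_diff_qmulj a z : differentiable a z ->
  is_diff z (fun r => qmul (a r) (Qj R)) (fun h => qmul ('d a z h) (Qj R)).
Proof.
move=> da.
have d1 := is_diff_comp (differentiableP da) (is_diff_fst _ _ _ _).
have d2 := is_diff_comp (differentiableP da) (is_diff_snd _ _ _ _).
have -> : (fun r => qmul (a r) (Qj R)) = (fun r => (- (a r).2, (a r).1)).
  by apply/funext => r; rewrite qmul_Qj.
have -> : (fun h => qmul ('d a z h) (Qj R)) = (fun h => (- ('d a z h).2, ('d a z h).1)).
  by apply/funext => r; rewrite qmul_Qj.
exact: is_diff_pair (is_diffN d2) d1.
Qed.

(** Right multiplication by [j] commutes with left multiplication by [N]. *)
Lemma holomorphic_qmulj b0 a : holomorphic b0 a -> holomorphic b0 (fun z => qmul (a z) (Qj R)).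
Proof.
move=> hol.
have D z v : 'D_v (fun r => qmul (a r) (Qj R)) z = qmul ('D_v a z) (Qj R).
  have [da _] := hol z; have [dj vj] := is_diff_qmulj a z da.
  have E1 := @deriveE _ _ _ a z v da.
  have E2 := @deriveE _ _ _ (fun r => qmul (a r) (Qj R)) z v dj.
  by rewrite [LHS]E2 vj E1.
apply: holomorphicP => z.
  by have [da _] := hol z; have [] := is_diff_qmulj a z da.
by rewrite /dx /dy !D qmulA; have [_ [e _]] := hol z; rewrite -/(dx a z) -/(dy a z) e.
Qed.

Lemma H0_trivial w1 w2 b0 a : holomorphic b0 a ->
  (forall z k1 k2, a (z + latpt w1 w2 k1 k2) = a z) -> H0 w1 w2 b0 (trivial_mult R) a.
Proof.
move=> hol per; split => // z k1 k2.
by rewrite per /mult_val /= !exp1rz mulr1 rmul1.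
Qed.

(** The left factor is [x (c + j d)] and the right one the conjugate of [c + j d], so their product
    is [x] times a squared norm. *)
Lemma qmul_ofC_conj x (c d : C) :
  qmul (rmul x c + rmul (qmul x (Qj R)) d)
    (mkQ (complex.Re c) (- complex.Im c) (- complex.Re d) (complex.Im d))
  = (complex.Re c ^+ 2 + complex.Im c ^+ 2 + complex.Re d ^+ 2 + complex.Im d ^+ 2 : R) *: x.
Proof.
case: x c d => [[x0 x1] [x2 x3]] [c0 c1] [d0 d1].
by apply: quat_eq; rewrite /= /GRing.scale /=; ring.
Qed.

Lemma rmul_span_eq0 x (c d : C) : x != 0 -> rmul x c + rmul (qmul x (Qj R)) d = 0 ->
  c = 0 /\ d = 0.
Proof.
move=> x0 e; have := qmul_ofC_conj x c d; rewrite e.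
rewrite (_ : qmul 0 _ = 0); last by apply: quat_eq; rewrite /=; ring.
move/esym/eqP; rewrite scaler_eq0 (negPf x0) orbF.
case: c d {e} => c0 c1 [d0 d1] /=.
rewrite !paddr_eq0 ?addr_ge0 ?sqr_ge0 // !sqrf_eq0.
by case/andP => /andP[/andP[/eqP -> /eqP ->] /eqP ->] /eqP ->.
Qed.

Lemma trivial_dim w1 w2 b0 f g : HS_torus w1 w2 b0 f g ->
  dimC_ge (H0 w1 w2 b0 (trivial_mult R)) 4.
Proof.
move=> [[W b00 bdual] [per df dfE gnz]].
have one0 : (mkQ 1 0 0 0 : quat R) != 0.
  by apply/eqP => -[/eqP]; rewrite oner_eq0.
have hf : holomorphic b0 f.
  apply: holomorphicP => // z; have [-> ->] := dfE z.
  by rewrite !qmulA Nrm_half.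
pose F : seq (plane R -> quat R) :=
  [:: (fun=> mkQ 1 0 0 0); (fun=> qmul (mkQ 1 0 0 0) (Qj R)); f; (fun z => qmul (f z) (Qj R))].
exists (fun i => nth (fun=> 0) F i); split.
  have h0 := H0_trivial w1 w2 b0 _ (holomorphic_cst b0 (mkQ 1 0 0 0)) (fun _ _ _ => erefl).
  have h1 := H0_trivial w1 w2 b0 _ (holomorphic_cst b0 (qmul (mkQ 1 0 0 0) (Qj R)))
    (fun _ _ _ => erefl).
  have h2 := H0_trivial w1 w2 b0 _ hf per.
  have h3 := H0_trivial w1 w2 b0 _ (holomorphic_qmulj _ _ hf)
    (fun z k1 k2 => congr1 (fun x : quat R => qmul x (Qj R)) (per z k1 k2)).
  case=> -[|[|[|[|j]]]] lt; [exact: h0|exact: h1|exact: h2|exact: h3|by []].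
move=> c cE.
pose c' j := c (inord j).
have {}cE z : rmul (mkQ 1 0 0 0) (c' 0%N) + rmul (qmul (mkQ 1 0 0 0) (Qj R)) (c' 1%N)
   + (rmul (f z) (c' 2%N) + rmul (qmul (f z) (Qj R)) (c' 3%N)) = 0.
  rewrite -[RHS](cE z) !big_ord_recl big_ord0 addr0 !addrA.
  by congr (rmul _ (c _) + rmul _ (c _) + rmul _ (c _) + rmul _ (c _));
     apply: val_inj; rewrite /= inordK.
have [c2 c3] : c' 2%N = 0 /\ c' 3%N = 0.
  apply: contrapT => nz.
  pose N : R := complex.Re (c' 2%N) ^+ 2 + complex.Im (c' 2%N) ^+ 2
    + complex.Re (c' 3%N) ^+ 2 + complex.Im (c' 3%N) ^+ 2.
  have N0 : N != 0.
    apply/eqP; rewrite /N => /eqP; rewrite !paddr_eq0 ?addr_ge0 ?sqr_ge0 // !sqrf_eq0.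
    case/andP => /andP[/andP[/eqP a1 /eqP a2] /eqP a3] /eqP a4; apply: nz.
    by split; apply: complex_eq.
  pose q1 := rmul (mkQ 1 0 0 0) (c' 0%N) + rmul (qmul (mkQ 1 0 0 0) (Qj R)) (c' 1%N).
  pose q2 := mkQ (complex.Re (c' 2%N)) (- complex.Im (c' 2%N)) (- complex.Re (c' 3%N)) (complex.Im (c' 3%N)).
  (* Solving the relation for [f] by right division by the nonzero quaternion [c2 + j c3] makes [f]
     constant, against [g 0 != 0]. *)
  have fc : f = (fun=> N^-1 *: qmul (- q1) q2).
    apply/funext => z; have := cE z; rewrite -/q1 addrC => /eqP; rewrite addr_eq0 => /eqP e.
    by rewrite -e qmul_ofC_conj scalerA mulVf // scale1r.
  have [dxf _] := dfE 0; have := gnz 0; apply/negP; rewrite negbK.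
  have dx0 : dx f 0 = 0 by rewrite /dx {1}fc derive_cst.
  move: dxf; rewrite dx0; set t := beta _ _ / 2 => e.
  have : qmul (expj (- t)) (qmul (expj t) (g 0)) = g 0.
    have cs := cos2Dsin2 t.
    have scale (r : R) : r = (cos t ^+ 2 + sin t ^+ 2) * r by rewrite cs mul1r.
    case: (g 0) => [[g0 g1] [g2 g3]].
    by apply: quat_eq; rewrite /= cosN sinN [RHS]scale; ring.
  by rewrite -e qmul0 => <-.
have [c0 c1] : c' 0%N = 0 /\ c' 1%N = 0.
  apply: (rmul_span_eq0 _ _ _ one0).
  have := cE 0; rewrite c2 c3.
  have r0 x : rmul x 0 = 0 by exact: qmul0.
  by rewrite !r0 !addr0.
move=> i; have -> : c i = c' i by rewrite /c' inord_val.
by case: i => [[|[|[|[|//]]]] lt].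
Qed.

End TrivialMultiplier.

(** * Generic dimension one and the uniform bound *)

Lemma H0_dim_ge1 (R : realType) (w1 w2 b0 : plane R) (h : multiplier R) :
  Spec w1 w2 b0 h -> dimC_ge (H0 w1 w2 b0 h) 1.
Proof.
move=> [_ _ [a [aH [z az]]]]; exists (fun=> a); split => // c cE i.
have := cE z; rewrite big_ord1 (ord1 i) => e.
apply: contra_neq_eq az => c0; apply: chi_inj.
  have := congr1 (chi1 R) e; rewrite chi1_rmul chi1_0 => /eqP.
  by rewrite mulf_eq0 (negPf c0) orbF => /eqP.
have := congr1 (chi2 R) e; rewrite chi2_rmul chi2_0 => /eqP.
by rewrite mulf_eq0 (negPf c0) orbF => /eqP.
Qed.

Theorem theorem2p6 (R : realType) (w1 w2 b0 : plane R) (f g : plane R -> quat R) :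
  HS_torus w1 w2 b0 f g ->
  [/\ (exists D : set (multiplier R), discrete_set D /\
         forall h, Spec w1 w2 b0 h -> ~ D h -> dimC_eq (H0 w1 w2 b0 h) 1),
      (exists s : seq (plane R), uniq s /\
         (forall p, p \in s <-> in_calD w1 w2 b0 p) /\
         forall h, Spec w1 w2 b0 h -> dimC_le (H0 w1 w2 b0 h) (size s))
    & dimC_ge (H0 w1 w2 b0 (trivial_mult R)) 4].
Proof.
move=> torus; have := torus => -[[W b00 bdual] _].
have /(in_dualP _ _ _ W) [n bE] := bdual.
have n1E : dotP b0 w1 = n.1%:~R by rewrite bE dotP_dvec1.
have n2E : dotP b0 w2 = n.2%:~R by rewrite bE dotP_dvec2.
have fr0 := freq_neq0 _ _ _ _ _ W b00 n1E n2E.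
have logs h : Spec w1 w2 b0 h ->
    exists l : R[i] * R[i], cexp R l.1 = h.1 /\ cexp R l.2 = h.2.
  move=> [h1 h2 _]; have [l1 e1] := cexp_surj _ _ h1; have [l2 e2] := cexp_surj _ _ h2.
  by exists (l1, l2).
split; last exact: trivial_dim torus.
  exists (resonant R w1 w2 n); split.
    exact: (resonant_discrete _ _ _ b0).
  move=> h hS nD; split; first exact: H0_dim_ge1.
  have [l [e1 e2]] := logs h hS.
  have [k kP] : exists k : int * int, forall k1 k2 : int,
      valid_mode R w1 w2 (freq R n.1 n.2) (l + freq R k1 k2) -> (k1, k2) = k.
    have [[k vk]|no] := pselect (exists k : int * int,
        valid_mode R w1 w2 (freq R n.1 n.2) (l + freq R k.1 k.2)); last first.
      by exists (0, 0) => k1 k2 v; case: no; exists (k1, k2).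
    (* A second valid frequency would make [h] resonant, with logarithm [l + freq k] and nonzero
       shift [(k1, k2) - k]. *)
    exists k => k1 k2 v; apply: contrapT => /eqP ne; apply: nD.
    exists (l + freq R k.1 k.2), ((k1, k2) - k); split => //.
    - by rewrite subr_eq0.
    - rewrite (surjective_pairing h) -e1 -e2 /=; congr (_, _); exact/esym/cexp_freq.
    - by rewrite -addrA -freqD /= !subrKC.
  apply: (H0_dim_bound _ _ _ _ _ n.1 n.2 l [:: k] 2 W fr0 n1E n2E e1 e2) => // k1 k2 v.
  by rewrite inE (kP k1 k2 v).
have [s [us sP]] := calD_enum _ _ _ b0 W.
exists s; split => //; split => // h hS.
have [l [e1 e2]] := logs h hS.
have [K [Ks KP]] := valid_count _ _ _ _ _ W b00 n1E n2E l s us sP.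
exact: (H0_dim_bound _ _ _ _ _ n.1 n.2 l K (size s).+1 W fr0 n1E n2E e1 e2 KP).
Qed.
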